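(* Consider the expectation problem (EX). Suppose Assumption B and Assumption V hold, $x^*$ is a minimizer of $\phi$ with $\phi^*=\phi(x^* )$, and $g_k$ is the sampled estimate with the sample-size rule. For $\epsilon>0$ let $K_\epsilon$ be the first iteration index $k$ with $\min\{\mathbb E[\phi(x_k)-\phi^*],\|R^{true}_{\alpha}(y_k)\|^2\}\le\epsilon$, and consider the number of stochastic gradient evaluations $\sum_{k=0}^{K_\epsilon-1}|S_k|$. (1) Option I with $\tilde\eta_k=\tilde\eta\in(0,1)$, $\tilde\iota_0^2\in[0,1-\tilde\eta)$, $\tilde\delta_k^2=\frac{1}{(k+1)^{1+\nu}}$ ($\nu>0$) and $\alpha_k=\alpha\le\frac{1-\tilde\eta-\tilde\iota_0^2}{L}$: this number is $\mathcal O(\epsilon^{-(2+\nu)})$; if instead $\tilde\delta_k=0$ for all $k$, it is $\mathcal O(\epsilon^{-2})$. (2) Option II with the convex acceleration sequences, $\tilde\eta_k=\tilde\eta\in(0,1)$, $\tilde\iota_0^2\in[0,1-\tilde\eta)$, $\tilde\delta_k^2=\frac{1}{(k+1)^{3+2\nu}}$ ($\nu>0$) and $\alpha_k=\alpha\le\frac{1-\tilde\eta-\tilde\iota_0^2}{L}$: this number is $\mathcal O(\epsilon^{-(2+\nu)})$; if instead $\tilde\delta_k=0$ for all $k$, it is $\mathcal O(\epsilon^{-3/2})$.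
   Context: Problem: minimize $\phi(x)=f(x)+h(x)$ over $x\in\mathbb{R}^d$. Assumption B: $f:\mathbb{R}^d\to\mathbb{R}$ is convex and continuously differentiable with $L$-Lipschitz continuous gradient ($L>0$), and $h:\mathbb{R}^d\to\mathbb{R}\cup\{+\infty\}$ is closed, convex and proper. Expectation problem (EX): $f(x)=\mathbb E_{\xi\sim\mathcal P}[F(x,\xi)]$. For $\alpha>0$, $\mathrm{prox}_{\alpha,h}(y)=\arg\min_{x\in\mathbb{R}^d}\{h(x)+\frac{1}{2\alpha}\|x-y\|^2\}$. Algorithm: given $x_0\in\mathbb{R}^d$, $y_0=x_0$, step sizes $\alpha_k>0$ and parameters $\beta_k$, for $k=0,1,2,\dots$: compute an estimate $g_k$ of $\nabla f(y_k)$; set $x_{k+1}=\mathrm{prox}_{\alpha_k,h}(y_k-\alpha_kg_k)$; under Option I set $y_{k+1}=x_{k+1}$, under Option II set $y_{k+1}=x_{k+1}+\beta_{k+1}(x_{k+1}-x_k)$. Define $R_{\alpha_k}(y_k)=\frac{1}{\alpha_k}(y_k-x_{k+1})$, $\hat x_{k+1}=\mathrm{prox}_{\alpha_k,h}(y_k-\alpha_k\nabla f(y_k))$ and $R^{true}_{\alpha_k}(y_k)=\frac{1}{\alpha_k}(y_k-\hat x_{k+1})$. Let $\mathcal G_k$ be the $\sigma$-algebra generated by $x_0,g_0,\dots,g_{k-1}$, $\mathbb E_k[\cdot]=\mathbb E[\cdot\mid\mathcal G_k]$, and $\mathbb E[\cdot]$ is total expectation. Condition C in (EX): for all $k\ge0$,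 $\mathbb E_k[\|g_k-\nabla f(y_k)\|^2]\le\frac{\tilde\eta_k^2}{4}\|\mathbb E_k[R_{\alpha_k}(y_k)]\|^2+\tilde\iota_0^2\tilde\delta_k^2$ with $\tilde\eta_k\in[0,1)$, $\tilde\iota_0\ge0$, $\tilde\delta_k\ge0$. Assumption V in (EX): there is $\sigma\ge0$ with $\mathbb E[\|\nabla F(y_k,\xi)-\nabla f(y_k)\|^2\mid\mathcal G_k]\le\sigma^2$ for all $k$, $\xi\sim\mathcal P$ independent of $\mathcal G_k$. Sampled estimate with sample-size rule: $g_k=\frac{1}{|S_k|}\sum_{\xi\in S_k}\nabla F(y_k,\xi)$, $S_k$ a set of i.i.d. samples from $\mathcal P$ independent of $\mathcal G_k$, with $|S_k|=\left\lceil\sigma^2/\left(\frac{\tilde\eta_k^2}{4}\|\mathbb E_k[R_{\alpha_k}(y_k)]\|^2+\tilde\iota_0^2\tilde\delta_k^2\right)\right\rceil$; each iteration costs $|S_k|$ stochastic gradient evaluations; this estimate is unbiased and satisfies Condition C. Convex acceleration sequences: $\beta_k=\frac{k-1}{k+2}$ for $k\ge1$, $\theta_k=\frac{2}{k+1}$ for $k\ge0$, $v_0=x_0$ and $v_k=x_{k-1}+\frac{1}{\theta_k}(x_k-x_{k-1})$ for $k\ge1$.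
   Formalization: The sample-size rule is undefined if its denominator is zero (possible when δ̃_k=0 or ι̃_0=0 and E_k[R]=0) and gives an empty sample if σ=0; the denominator is therefore assumed positive at every iteration, and |S_k| is taken to be at least 1. *)

(* Defs.v *)
From mathcomp Require Import all_boot all_algebra.
From mathcomp Require Import all_classical all_reals all_analysis.
Import GRing.Theory Num.Theory.

Set Implicit Arguments.
Unset Strict Implicit.
Unset Printing Implicit Defensive.

Local Open Scope ring_scope.
Local Open Scope classical_set_scope.

Section Euclid.
Variables (R : realType) (d : nat).

Definition dotv (u v : 'rV[R]_d) : R := \sum_(i < d) u 0 i * v 0 i.
Definition sqn (u : 'rV[R]_d) : R := dotv u u.
Definition enorm (u : 'rV[R]_d) : R := Num.sqrt (sqn u).

Definition is_gradient (f : 'rV[R]_d -> R) (gf : 'rV[R]_d -> 'rV[R]_d) :=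
  forall x, differentiable f x /\ forall v, 'd f x v = dotv (gf x) v.

Definition convex_fun (f : 'rV[R]_d -> R) :=
  forall (x y : 'rV[R]_d) (t : R), 0 <= t <= 1 ->
    f (t *: x + (1 - t) *: y) <= t * f x + (1 - t) * f y.

Definition convex_efun (h : 'rV[R]_d -> \bar R) :=
  forall (x y : 'rV[R]_d) (t : R), 0 <= t <= 1 ->
    (h (t *: x + (1 - t) *: y)%R <= t%:E * h x + (1 - t)%R%:E * h y)%E.

Definition proper_efun (h : 'rV[R]_d -> \bar R) :=
  (forall x, h x != -oo%E) /\ exists x, h x \is a fin_num.

Definition closed_efun (h : 'rV[R]_d -> \bar R) :=
  @lower_semicontinuous ('rV[R]_d : normedModType R) R h.

Definition is_prox (h : 'rV[R]_d -> \bar R) (a : R) (y p : 'rV[R]_d) :=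
  forall z : 'rV[R]_d,
    (h p + (sqn (p - y) / (2 * a))%:E <= h z + (sqn (z - y) / (2 * a))%:E)%E.

Definition phi_of (f : 'rV[R]_d -> R) (h : 'rV[R]_d -> \bar R) x : \bar R :=
  ((f x)%:E + h x)%E.

Definition Rtrue (prox : R -> 'rV[R]_d -> 'rV[R]_d) (gf : 'rV[R]_d -> 'rV[R]_d)
  (a : R) (y : 'rV[R]_d) : 'rV[R]_d :=
  a^-1 *: (y - prox a (y - a *: gf y)).

End Euclid.

Section Prob.
Variables (R : realType) (dO : measure_display) (O : measurableType dO)
  (P : probability O R).

Definition preim_sys (X : O -> R) : set (set O) :=
  [set X @^-1` B | B in measurable].

(* preimage sets of all coordinates of a random vector; it generates the
   sigma-algebra sigma(X) (the Borel sets of R^d are generated by coordinates) *)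
Definition preim_sys_vec d (X : O -> 'rV[R]_d) : set (set O) :=
  \bigcup_(j in [set: 'I_d]) preim_sys (fun w => X w 0 j).

Definition filtr d (x0 : O -> 'rV[R]_d) (g : nat -> O -> 'rV[R]_d) (k : nat)
  : set (set O) :=
  <<s preim_sys_vec x0 `|` \bigcup_(i in [set i | (i < k)%N]) preim_sys_vec (g i) >>.

Definition is_condexp (G : set (set O)) (X Z : O -> R) :=
  [/\ G `<=` measurable,
      (forall B, measurable B -> G (Z @^-1` B)),
      P.-integrable setT (fun w => (X w)%:E),
      P.-integrable setT (fun w => (Z w)%:E) &
      forall A, G A -> (\int[P]_(w in A) (Z w)%:E = \int[P]_(w in A) (X w)%:E)%E].

Definition is_condexp_vec d (G : set (set O)) (X Z : O -> 'rV[R]_d) :=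
  forall j : 'I_d, is_condexp G (fun w => X w 0 j) (fun w => Z w 0 j).

Definition mutual_indep (I : eqType) (S : I -> set (set O)) :=
  forall (J : seq I) (A : I -> set O), uniq J ->
    (forall i, i \in J -> S i (A i)) ->
    P (\big[setI/setT]_(i <- J) A i) = (\prod_(i <- J) fine (P (A i)))%:E.

End Prob.

(* |S_k| = ceil( sigma^2 / (eta^2/4 ||E_k R||^2 + iota0^2 delta_k^2) )
   (a sample set is nonempty, hence the max with 1) *)
Definition sample_size (R : realType) (sigma eta iota0sq deltasq cn2 : R) : nat :=
  maxn 1 (absz (Num.ceil (sigma ^+ 2 / (eta ^+ 2 / 4 * cn2 + iota0sq * deltasq)))).

Definition beta_acc (R : realType) (k : nat) : R := (k%:R - 1) / (k%:R + 2).

(* One run of the method in (EX) with the sampled gradient estimate and the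
   sample-size rule.  optII = false: Option I; optII = true: Option II with
   the convex acceleration parameters.  Constant step alpha_k = alpha,
   tilde eta_k = eta, tilde iota_0^2 = iota0sq, tilde delta_k^2 = deltasq k. *)
Definition sampled_run (R : realType) (d : nat)
  (dO : measure_display) (O : measurableType dO) (P : probability O R)
  (dX : measure_display) (Xi : measurableType dX) (Pxi : probability Xi R)
  (gF : 'rV[R]_d -> Xi -> 'rV[R]_d) (prox : R -> 'rV[R]_d -> 'rV[R]_d)
  (optII : bool) (alpha sigma eta iota0sq : R) (deltasq : nat -> R)
  (x y g c : nat -> O -> 'rV[R]_d) (N : nat -> O -> nat)
  (xi : nat -> nat -> O -> Xi) : Prop :=
  let G := filtr (x 0%N) g in
  let Rk k w := alpha^-1 *: (y k w - x k.+1 w) in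
  (exists x0 : 'rV[R]_d, forall w, x 0%N w = x0)
  /\ y 0%N = x 0%N
  /\
      (forall k j, measurable_fun setT (xi k j) /\
         forall A, measurable A -> P (xi k j @^-1` A) = Pxi A)
  /\
      (forall k, mutual_indep P (fun i : option nat =>
         match i with None => G k | Some j => [set xi k j @^-1` B | B in measurable] end))
  /\
      (forall k, is_condexp_vec P (G k) (Rk k) (c k))
  /\
      (* sample-size rule (well-defined: positive denominator) *)
      (forall k w, 0 < eta ^+ 2 / 4 * sqn (c k w) + iota0sq * deltasq k /\
          N k w = sample_size sigma eta iota0sq (deltasq k) (sqn (c k w)))
  /\
      (forall k w, g k w = (N k w)%:R^-1 *: \sum_(j < N k w) gF (y k w) (xi k j w))
  /\
      (forall k w, x k.+1 w = prox alpha (y k w - alpha *: g k w))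
  /\
      (forall k w, y k.+1 w =
         if optII then x k.+1 w + beta_acc R k.+1 *: (x k.+1 w - x k w)
         else x k.+1 w).

(* Assumption V along the iterates: E[||grad F(y_k,xi) - grad f(y_k)||^2 | G_k]
   <= sigma^2 with xi ~ Pxi independent of G_k; since y_k is G_k-measurable
   and xi is independent of G_k, this conditional expectation is (a.s.) the
   Pxi-integral below evaluated at y = y_k. *)
Definition assumptionV (R : realType) (d : nat)
  (dO : measure_display) (O : measurableType dO) (P : probability O R)
  (dX : measure_display) (Xi : measurableType dX) (Pxi : probability Xi R)
  (gF : 'rV[R]_d -> Xi -> 'rV[R]_d) (gf : 'rV[R]_d -> 'rV[R]_d) (sigma : R)
  (y : nat -> O -> 'rV[R]_d) : Prop :=
  forall k, {ae P, forall w,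
    (\int[Pxi]_(z in setT) (sqn (gF (y k w) z - gf (y k w)))%:E <= (sigma ^+ 2)%:E)%E}.

(* "sum_{k=0}^{K_eps - 1} |S_k| = O(eps^{-rate})", where K_eps is the first k with
   min{ Eterm k, rterm k } <= eps.  Eterm k = E[phi(x_k) - phi^*] (deterministic),
   rterm k w = ||R^true_alpha(y_k)||^2 (random), so K_eps and the count are random;
   the bound is claimed almost surely, with C independent of eps, and includes
   the existence (finiteness) of K_eps. *)
Definition evals_bigO (R : realType)
  (dO : measure_display) (O : measurableType dO) (P : probability O R)
  (Eterm : nat -> \bar R) (rterm : nat -> O -> R) (N : nat -> O -> nat) (rate : R)
  : Prop :=
  let reached (eps : R) k w := (mine (Eterm k) (rterm k w)%:E <= eps%:E)%E in
  exists C eps0 : R, 0 < C /\ 0 < eps0 /\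
    forall eps : R, 0 < eps <= eps0 ->
      {ae P, forall w, exists K : nat,
         reached eps K w /\ (forall k, (k < K)%N -> ~ reached eps k w) /\
         (\sum_(k < K) N k w)%:R <= C * eps `^ (- rate)}.

Definition gap_exp (R : realType) (d : nat)
  (dO : measure_display) (O : measurableType dO) (P : probability O R)
  (phi : 'rV[R]_d -> \bar R) (xstar : 'rV[R]_d) (x : nat -> O -> 'rV[R]_d) (k : nat)
  : \bar R :=
  (\int[P]_(w in setT) (phi (x k w) - phi xstar))%E.

(* Main.v *)
(** Write [e_k = g_k - grad f(y_k)] and [xh_k] for the exact proximal point of
    [y_k]. Convexity, the descent lemma and nonexpansiveness of the prox give,
    for every [z] and along every path,
      [phi(x_(k+1)) - phi(z) <= - <e_k, xh_k - z> + alpha |e_k|^2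
         + (|y_k - z|^2 - |x_(k+1) - z|^2) / (2 alpha) - (alpha / 2) (1 - L alpha) |R_k|^2].
    If [z] is [G_k]-measurable the first term has mean zero, because [xh_k] is
    [G_k]-measurable and the samples are independent of [G_k]; the sample-size rule
    bounds [E |e_k|^2] by [eta^2 / 4 E |c_k|^2 + iota0sq delta_k] and
    [E |c_k|^2 <= E |R_k|^2], so that the [|R_k|^2] terms cancel. With [z = xstar]
    the gaps are summable under Option I; with [z = (1 - theta) x_k + theta xstar]
    they are [O(1/k^2)] under Option II. Hence [K_eps] is at most of order [1/eps],
    respectively [eps^(-1/2)], deterministically. If [iota0sq delta_k > 0] the number
    of samples is at most [2 + sigma^2 / (iota0sq delta_k)]; if it vanishes, the same
    variance bound localised on [G_k]-events gives
    [|Rtrue(y_k)|^2 <= (2 + eta^2 / 2) |c_k|^2] almost surely, so before [K_eps] the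
    number of samples is [O(1/eps)]. *)

(* The new iterate depends on the same samples as [e_k], so [<e_k, x_(k+1) - z>] has no reason to
   average to zero. Replacing [x_(k+1)] by [xh_k] costs only [alpha |e_k|^2], because the prox moves
   by at most [alpha |e_k|]. The sample number is random as well. It is [G_k]-measurable, so every
   statement about [g_k] is proved on the events [{N_k = n}], where the number of samples is fixed,
   and then summed over [n]. The starting point may lie outside the domain of [h], so the gap at
   index 0 may be infinite. All gap estimates therefore start at index 1, which accounts for the
   additive 1 in the iteration constants. The two terms of the minimum have separate uses: the
   expected gap is deterministic and bounds [K_eps], while the residual bounds the cost of one
   iteration when [iota0sq delta_k] vanishes. With [K_eps = O(eps^(-a))] and cost [O((k + 1)^b)] the
   exponent is [a (1 + b)]: [1 + (1 + nu)] for Option I and [(1 + 3 + 2 nu) / 2] for Option II, both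
   [2 + nu]. With cost [O(1 / eps)] it is [a + 1], that is [2] and [3 / 2]. *)
Require Import Defs.
From HB Require Import structures.
From mathcomp Require Import all_boot all_order all_algebra.
From mathcomp Require Import all_classical all_reals all_analysis.
From mathcomp Require Import measurable_realfun.
From mathcomp Require Import ring lra.
Import Order.TTheory GRing.Theory Num.Theory.
Import numFieldNormedType.Exports.

Set Implicit Arguments.
Unset Strict Implicit.
Unset Printing Implicit Defensive.

Local Open Scope ring_scope.
Local Open Scope classical_set_scope.

(** * Euclidean geometry *)

Section Dot.
Variables (R : realType) (d : nat).
Implicit Types (u v w : 'rV[R]_d) (a b : R).

Lemma dotvC u v : dotv u v = dotv v u.
Proof. by apply: eq_bigr => i _; rewrite mulrC. Qed.

Lemma dotvDl u v w : dotv (u + v) w = dotv u w + dotv v w.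
Proof. by rewrite -big_split; apply: eq_bigr => i _; rewrite !mxE mulrDl. Qed.

Lemma dotvZl a u v : dotv (a *: u) v = a * dotv u v.
Proof. by rewrite mulr_sumr; apply: eq_bigr => i _; rewrite !mxE mulrA. Qed.

Lemma dotvNl u v : dotv (- u) v = - dotv u v.
Proof. by rewrite -scaleN1r dotvZl mulN1r. Qed.

Lemma dotvDr u v w : dotv w (u + v) = dotv w u + dotv w v.
Proof. by rewrite dotvC dotvDl !(dotvC w). Qed.

Lemma dotvZr a u v : dotv u (a *: v) = a * dotv u v.
Proof. by rewrite dotvC dotvZl dotvC. Qed.

Lemma dotvNr u v : dotv u (- v) = - dotv u v.
Proof. by rewrite dotvC dotvNl dotvC. Qed.

Definition dotvE := (dotvDl, dotvDr, dotvNl, dotvNr, dotvZl, dotvZr).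

Lemma sqn_ge0 u : 0 <= sqn u.
Proof. by apply: sumr_ge0 => i _; rewrite -expr2 sqr_ge0. Qed.

Lemma sqnZ a u : sqn (a *: u) = a ^+ 2 * sqn u.
Proof. by rewrite /sqn !dotvE; ring. Qed.

Lemma sqnN u : sqn (- u) = sqn u.
Proof. by rewrite /sqn !dotvE opprK. Qed.

Lemma sqnBC u v : sqn (u - v) = sqn (v - u).
Proof. by rewrite -sqnN opprB. Qed.

Lemma sqnD u v : sqn (u + v) = sqn u + 2 * dotv u v + sqn v.
Proof. by rewrite /sqn !dotvE (dotvC v u); ring. Qed.

Lemma sqnB u v : sqn (u - v) = sqn u - 2 * dotv u v + sqn v.
Proof. by rewrite sqnD dotvNr sqnN; ring. Qed.

Lemma sqnD_le u v : sqn (u + v) <= 2 * sqn u + 2 * sqn v.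
Proof. by have := sqn_ge0 (u - v); rewrite sqnB sqnD; lra. Qed.

Lemma sqr_coord_le_sqn u j : u 0 j ^+ 2 <= sqn u.
Proof.
rewrite /sqn /dotv (bigD1 j)//= expr2 lerDl.
by apply: sumr_ge0 => i _; rewrite -expr2 sqr_ge0.
Qed.

Lemma dotv_young u v s : 0 < s -> 2 * dotv u v <= s * sqn u + sqn v / s.
Proof.
move=> s0; have := sqn_ge0 (s *: u - v).
rewrite sqnB sqnZ dotvZl => H.
have : 0 <= s^-1 * (s ^+ 2 * sqn u - 2 * (s * dotv u v) + sqn v).
  by rewrite mulr_ge0// invr_ge0 ltW.
have -> : s^-1 * (s ^+ 2 * sqn u - 2 * (s * dotv u v) + sqn v) =
  s * sqn u - 2 * dotv u v + sqn v / s by field; rewrite gt_eqF.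
lra.
Qed.

Lemma enorm_sqr u : enorm u ^+ 2 = sqn u.
Proof. by rewrite /enorm sqr_sqrtr// sqn_ge0. Qed.

End Dot.

(** * The proximal operator of a convex function *)

Section Prox.
Variables (R : realType) (d : nat) (h : 'rV[R]_d -> \bar R).
Hypothesis hcvx : convex_efun h.
Hypothesis hprop : proper_efun h.

Lemma is_prox_fin_num a v p : is_prox h a v p -> h p \is a fin_num.
Proof.
case: hprop => hN [z hz] pp; have := pp z.
have := hN p; case: (h p) => [r|//|//] _ //=.
by rewrite -(fineK hz) addye// -EFinD leye_eq.
Qed.

(** This is the subgradient form of optimality: [(v - p) / a] is a subgradient of [h] at [p].
    Minimality is tested at the points [t z + (1 - t) p] of the segment, divided by [t], and [t] is
    sent to 0. *)
Lemma is_prox_le a v p z : 0 < a -> is_prox h a v p -> h z \is a fin_num ->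
  fine (h p) + a^-1 * dotv (p - v) (p - z) <= fine (h z).
Proof.
move=> a0 pp hz; have hp := is_prox_fin_num pp.
set A := a^-1 * dotv (p - v) (p - z).
set B := sqn (z - p) / (2 * a).
have B0 : 0 <= B by rewrite divr_ge0 ?sqn_ge0// mulr_ge0// ltW.
have key t : 0 < t <= 1 -> fine (h p) + A <= fine (h z) + t * B.
  move=> /andP[t0 t1].
  have := pp (t *: z + (1 - t) *: p).
  have /(hcvx z p) : 0 <= t <= 1 by rewrite ltW.
  rewrite -(fineK hz) -(fineK hp).
  move: (fine (h z)) (fine (h p)) => z' p' H1 H2.
  have : (p'%:E + (sqn (p - v) / (2 * a))%:E <= (t%:E * z'%:E + (1 - t)%:E * p'%:E) +
    (sqn (t *: z + (1 - t) *: p - v) / (2 * a))%:E)%E.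
    by apply: le_trans H2 _; exact: leeD.
  rewrite -!(EFinM, EFinD) lee_fin.
  have -> : t *: z + (1 - t) *: p - v = (p - v) + t *: (z - p).
    by rewrite scalerBl scale1r scalerBr; apply/rowP => i; rewrite !mxE; ring.
  rewrite (sqnD (p - v)) sqnZ dotvZr => H3.
  have Apz : dotv (p - v) (z - p) = - (a * A).
    by rewrite -(opprB p z) dotvNr /A mulrA divff ?gt_eqF// mul1r.
  have Bzp : sqn (z - p) = 2 * a * B.
    by rewrite /B mulrC divfK// mulf_neq0 ?gt_eqF.
  move: H3; rewrite Apz Bzp.
  have -> : (sqn (p - v) + 2 * (t * - (a * A)) + t ^+ 2 * (2 * a * B)) / (2 * a) =
    sqn (p - v) / (2 * a) - t * A + t ^+ 2 * B by field; rewrite gt_eqF.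
  move=> H3; have H4 : t * (p' + A) <= t * (z' + t * B) by lra.
  by rewrite ler_pM2l in H4.
rewrite -/A; apply/ler_addgt0Pr => e e0.
have [B00|B1] := eqVneq B 0.
  by have := key 1; rewrite B00 ltr01 lexx => /(_ isT); lra.
have Bp : 0 < B by rewrite lt_neqAle eq_sym B1.
(* This [t] is admissible and makes the quadratic remainder [t * B] at most [e]. *)
have := key (Num.min 1 (e / B)).
rewrite lt_min ltr01 divr_gt0//= ge_min lexx => /(_ isT) /le_trans; apply.
by rewrite lerD2l -ler_pdivlMr// ge_min lexx orbT.
Qed.

(** Testing each optimality inequality at the other proximal point and adding cancels [h] and leaves
    [sqn (p1 - p2) <= dotv (v1 - v2) (p1 - p2)]. Expanding the square of [(v1 - v2) - (p1 - p2)]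
    then gives the claim. *)
Lemma is_prox_nonexpansive a v1 v2 p1 p2 : 0 < a ->
  is_prox h a v1 p1 -> is_prox h a v2 p2 -> sqn (p1 - p2) <= sqn (v1 - v2).
Proof.
move=> a0 H1 H2.
have := is_prox_le a0 H1 (is_prox_fin_num H2).
have := is_prox_le a0 H2 (is_prox_fin_num H1).
move=> A1 A2.
have : a^-1 * (dotv (p2 - v2) (p2 - p1) + dotv (p1 - v1) (p1 - p2)) <= 0 by lra.
rewrite pmulr_rle0 ?invr_gt0// => A3.
have := sqn_ge0 ((v1 - v2) - (p1 - p2)).
rewrite sqnB.
have : dotv (p2 - v2) (p2 - p1) + dotv (p1 - v1) (p1 - p2) =
  sqn (p1 - p2) - dotv (v1 - v2) (p1 - p2).
  rewrite /sqn !dotvE; rewrite (dotvC p2 p1); ring.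
lra.
Qed.

End Prox.

(** * Convex functions with Lipschitz gradient *)

Section Smooth.
Variables (R : realType) (d : nat) (f : 'rV[R]_d -> R) (gf : 'rV[R]_d -> 'rV[R]_d).
Hypothesis gradf : is_gradient f gf.

(** The derivative is taken along the sequence [1 / (n + 1)] so that it is a countable limit of
    difference quotients: convexity passes to this limit, and so does measurability in
    [gradient_measurable]. *)
Lemma is_gradient_cvg x v :
  (fun n => n.+1%:R * (f (x + n.+1%:R^-1 *: v) - f x)) @ \oo --> dotv (gf x) v.
Proof.
have [df Df] := gradf x; rewrite -Df -deriveE//.
have /cvg_ex[l fl] : derivable f x v by exact: diff_derivable.
have -> : 'D_v f x = l by apply/cvg_lim.
move/cvgrPdist_le : fl => fl; apply/cvgrPdist_le => e e0.
have := fl _ e0 => -[/= r r0 H].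
have : (fun n => n.+1%:R^-1 : R) @ \oo --> (0 : R) by exact: cvg_harmonic.
move/cvgrPdist_lt => /(_ _ r0) [N _ HN].
exists N => // n /HN /=; rewrite sub0r normrN => Hn.
have := H n.+1%:R^-1; rewrite /ball_ /= sub0r normrN => /(_ Hn).
have n0 : n.+1%:R^-1 != 0 :> R by rewrite invr_eq0 pnatr_eq0.
by move=> /(_ n0); rewrite invrK [X in f X]addrC.
Qed.

Hypothesis fcvx : convex_fun f.

Lemma convex_gradient_le x z : f x + dotv (gf x) (z - x) <= f z.
Proof.
rewrite -lerBrDl; have /cvg_lim <- // := @is_gradient_cvg x (z - x).
apply: limr_le; first by apply/cvg_ex; eexists; exact: is_gradient_cvg.
near=> n.
have n0 : 0 < n.+1%:R :> R by rewrite ltr0n.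
have := fcvx z x (t := n.+1%:R^-1).
rewrite invr_ge0 ltW//= invf_le1// ler1n => /(_ isT).
have -> : n.+1%:R^-1 *: z + (1 - n.+1%:R^-1) *: x = x + n.+1%:R^-1 *: (z - x).
  by apply/rowP => i; rewrite !mxE; ring.
set t := n.+1%:R^-1.
set F := f _ => H.
have : F - f x <= t * (f z - f x) by lra.
by rewrite /t mulrC ler_pdivlMr// mulrC.
Unshelve. all: by end_near.
Qed.

Variable L : R.
Hypothesis L0 : 0 < L.
Hypothesis lip : forall u v, sqn (gf u - gf v) <= L ^+ 2 * sqn (u - v).

(* Summing the gradient inequality over [n] equal pieces of the segment gives
   the constant [L (n + 1) / (2 n)], hence [L / 2] in the limit. *)
Lemma descent_lemma x y :
  f y <= f x + dotv (gf x) (y - x) + L / 2 * sqn (y - x).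
Proof.
set v := y - x; set S := sqn v.
have S0 : 0 <= S by exact: sqn_ge0.
have key (n i : nat) : let t : R := n.+1%:R^-1 in
   f (x + (i%:R * t) *: v) <= f x + i%:R * t * dotv (gf x) v +
     L * S * (i%:R * (i%:R + 1)) / 2 * t ^+ 2.
  move=> t; have t0 : 0 < t by rewrite invr_gt0 ltr0n.
  elim: i => [|i IH].
    by rewrite !mul0r scale0r addr0 mulr0 !mul0r !addr0.
  set p := x + (i.+1%:R * t) *: v.
  have := convex_gradient_le p (x + (i%:R * t) *: v).
  have -> : x + (i%:R * t) *: v - p = - t *: v.
    by rewrite /p -natr1; apply/rowP => j; rewrite !mxE; ring.
  rewrite dotvZr => H.
  (* This weight balances Young's inequality: [p - x] has length [(i + 1) t |v|], so by the
     Lipschitz bound both resulting terms are at most [L (i + 1) t S]. *)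
  have s0 : 0 < L * (i.+1%:R * t) by rewrite !mulr_gt0.
  have Y := dotv_young v (gf p - gf x) s0.
  have lp := lip p x.
  have : sqn (gf p - gf x) / (L * (i.+1%:R * t)) <= L * (i.+1%:R * t) * S.
    rewrite ler_pdivrMr//; apply: (le_trans lp).
    rewrite /p addrC addKr sqnZ -/S le_eqVlt; apply/orP; left; apply/eqP; ring.
  move=> Hs; have D : dotv (gf p) v <= dotv (gf x) v + L * (i.+1%:R * t) * S.
    move: Y Hs; rewrite dotvC dotvDl dotvNl -/S.
    by move: (_ / (L * _)) (L * _ * S) => q1 q2; lra.
  have D2 : t * dotv (gf p) v <= t * (dotv (gf x) v + L * (i.+1%:R * t) * S).
    by rewrite ler_pM2l.
  apply: (@le_trans _ _ (f x + i%:R * t * dotv (gf x) v +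
     L * S * (i%:R * (i%:R + 1)) / 2 * t ^+ 2 + t * dotv (gf p) v)); first lra.
  apply: (@le_trans _ _ (f x + i%:R * t * dotv (gf x) v +
     L * S * (i%:R * (i%:R + 1)) / 2 * t ^+ 2 +
     t * (dotv (gf x) v + L * (i.+1%:R * t) * S))); first lra.
  rewrite le_eqVlt; apply/orP; left; apply/eqP; rewrite -natr1.
  by clear; clearbody t; field.
apply/ler_addgt0Pr => e e0.
have [n Hn] : exists n : nat, L * S / 2 / e < n.+1%:R.
  by exists (Num.truncn (L * S / 2 / e)); rewrite truncnS_gt.
have := key n n.+1; rewrite /= divff ?pnatr_eq0// scale1r mul1r.
rewrite [x + _]addrC subrK => /le_trans; apply.
rewrite -!addrA lerD2l lerD2l.
have n0 : 0 < n.+1%:R :> R by rewrite ltr0n.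
have -> : L * S * (n.+1%:R * (n.+1%:R + 1)) / 2 * n.+1%:R^-1 ^+ 2 =
  L / 2 * S + (L * S / 2) / n.+1%:R by field; rewrite nat1r pnatr_eq0.
by rewrite lerD2l ler_pdivrMr// [e * _]mulrC -ler_pdivrMr// ltW.
Qed.

End Smooth.

(* [gx] is the inexact gradient, [xh] the exact proximal point. *)
Lemma prox_step_le (R : realType) (d : nat) (f : 'rV[R]_d -> R) gf h L a
  (y gx xp xh z : 'rV[R]_d) :
  is_gradient f gf -> convex_fun f -> 0 < L ->
  (forall u v, sqn (gf u - gf v) <= L ^+ 2 * sqn (u - v)) ->
  convex_efun h -> proper_efun h -> 0 < a ->
  is_prox h a (y - a *: gx) xp -> is_prox h a (y - a *: gf y) xh ->
  h z \is a fin_num ->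
  f xp + fine (h xp) <= f z + fine (h z) - dotv (gx - gf y) (xh - z)
    + a * sqn (gx - gf y) + (2 * a)^-1 * (sqn (y - z) - sqn (xp - z))
    - a / 2 * (1 - L * a) * sqn (a^-1 *: (y - xp)).
Proof.
move=> gradf fcvx L0 lip hcvx hprop a0 pp ph hz.
have H1 := is_prox_le hcvx hprop a0 pp hz.
have H2 := descent_lemma gradf fcvx L0 lip y xp.
have H3 := convex_gradient_le gradf fcvx y z.
have H4 := is_prox_nonexpansive hcvx hprop a0 pp ph.
set e := gx - gf y in H1 H2 H3 H4 *.
have a1 : a != 0 by rewrite gt_eqF.
have gE : gx = gf y + e by rewrite /e addrC subrK.
have e2 : sqn (xp - xh) <= a ^+ 2 * sqn e.
  apply: (le_trans H4); rewrite gE.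
  have -> : y - a *: (gf y + e) - (y - a *: gf y) = (- a) *: e.
    by apply/rowP => i; rewrite !mxE; ring.
  by rewrite sqnZ sqrrN.
(* With weight [a] each half of Young's bound is at most [a * sqn e], since
   [sqn (xh - xp) <= a ^+ 2 * sqn e]. Trading [xp] for [xh] against [e] thus costs exactly one
   [a * sqn e]. *)
have Y := dotv_young e (xh - xp) a0.
have Y' : sqn (xh - xp) / a <= a * sqn e.
  rewrite ler_pdivrMr// sqnBC (le_trans e2)//.
  by rewrite le_eqVlt; apply/orP; left; apply/eqP; ring.
move: H1; rewrite gE.
have -> : xp - (y - a *: (gf y + e)) = (xp - y) + a *: gf y + a *: e.
  by apply/rowP => i; rewrite !mxE; ring.
rewrite 2!dotvDl (dotvZl a (gf y)) (dotvZl a e).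
have -> : a^-1 * (dotv (xp - y) (xp - z) + a * dotv (gf y) (xp - z) + a * dotv e (xp - z)) =
  a^-1 * dotv (xp - y) (xp - z) + dotv (gf y) (xp - z) + dotv e (xp - z) by field.
rewrite sqnZ.
have -> : dotv (xp - y) (xp - z) = (sqn (xp - y) + sqn (xp - z) - sqn (y - z)) / 2.
  have -> : y - z = (xp - z) - (xp - y) by apply/rowP => i; rewrite !mxE; ring.
  by rewrite (sqnB (xp - z)) (dotvC (xp - z)); field.
rewrite (sqnBC y xp).
have -> : a / 2 * (1 - L * a) * (a^-1 ^+ 2 * sqn (xp - y)) =
  (2 * a)^-1 * sqn (xp - y) - L / 2 * sqn (xp - y) by field.
have -> : a^-1 * ((sqn (xp - y) + sqn (xp - z) - sqn (y - z)) / 2) =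
  (2 * a)^-1 * (sqn (xp - y) + sqn (xp - z) - sqn (y - z)) by field.
move: H2 H3 Y; rewrite !dotvE.
move: (sqn (xp - y)) (sqn (xp - z)) (sqn (y - z)) ((2 * a)^-1) => s1 s2 s3 b.
move: Y'; move: (sqn (xh - xp) / a) (a * sqn e) => t1 t2; lra.
Qed.

(** * Measurability of random vectors *)

Section MeasurableVector.
Variables (R : realType) (d : nat) (dT : measure_display) (T : measurableType dT).
Implicit Type X : T -> 'rV[R]_d.

(** The coordinatewise form matches the generators [preim_sys_vec] of the filtration. The source
    type is left free so that it can carry a sub-sigma-algebra. *)
Definition mvec X := forall j, measurable_fun setT (fun w => X w 0 j).

Lemma measurable_coordwise (X : T -> 'rV[R]_d) (S : 'I_d -> set R) : mvec X ->
  (forall j, measurable (S j)) -> measurable [set w | forall j, S j (X w 0 j)].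
Proof.
move=> mX mS.
rewrite (_ : [set _ | _] = \bigcap_(j in [set: 'I_d]) ((fun w => X w 0 j) @^-1` S j)).
  apply: fin_bigcap_measurable => // j _.
  by rewrite -[X in measurable X]setTI; exact: mX.
by apply/seteqP; split => [w wS j _|w wS j]; [exact: wS|exact: wS j I].
Qed.

(** An open set is the union of the balls with rational centre and radius [1 / (n + 1)] that it
    contains. There are countably many, and a ball of the sup norm is a product of intervals, so its
    preimage is seen coordinate by coordinate. *)
Lemma mvec_open X (U : set 'rV[R]_d) : mvec X -> open U -> measurable (X @^-1` U).
Proof.
move=> mX oU.
pose r (q : 'rV[rat]_d) : 'rV[R]_d := \row_j ratr (q 0 j).
pose B (p : 'rV[rat]_d * nat) : set 'rV[R]_d := ball (r p.1) p.2.+1%:R^-1.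
have BE p : X @^-1` B p = [set w | forall j, ball (r p.1 0 j) p.2.+1%:R^-1 (X w 0 j)].
  apply/seteqP; split => [w [_ wB] j|w wB]; first exact: wB.
  by split; [rewrite invr_gt0|move=> i j; rewrite ord1].
have mB p : measurable (X @^-1` B p).
  rewrite BE; apply: (@measurable_coordwise X (fun j => ball (r p.1 0 j) p.2.+1%:R^-1)) => //.
  by move=> j; exact: measurable_ball.
rewrite (_ : X @^-1` U =
    \bigcup_p (if `[< B p `<=` U >] then X @^-1` B p else set0)); last first.
  apply/seteqP; split => [w Uw|w [p _]]; last first.
    by case: asboolP => // BU; exact: BU.
  have /nbhs_ballP[e /= e0 eU] : nbhs (X w) U.
    by move: oU; rewrite openE => /(_ _ Uw).
  have [n] : exists n : nat, 2 / e < n.+1%:R.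
    by exists (Num.truncn (2 / e)); rewrite truncnS_gt.
  have n0 : 0 < n.+1%:R^-1 :> R by rewrite invr_gt0.
  rewrite ltr_pdivrMr// mulrC -ltr_pdivrMr// => ne.
  have ne' : n.+1%:R^-1 <= e / 2 by rewrite ler_pdivlMr// mulrC ltW.
  have Q j : exists q : rat, `|ratr q - X w 0 j| < n.+1%:R^-1.
    have /rat_in_itvoo[q] : X w 0 j - n.+1%:R^-1 < X w 0 j + n.+1%:R^-1.
      by rewrite ltrBlDr -addrA ltrDl addr_gt0.
    by rewrite in_itv/= => qi; exists q; rewrite ltr_distl.
  have [q /= qP] := choice Q.
  pose qv : 'rV_d := \row_j q j.
  have wB : B (qv, n) (X w).
    by split => // i j; rewrite ord1 !mxE; exact: qP.
  exists (qv, n) => //.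
  case: asboolP => //; case; move=> x [_ xB]; apply: eU.
  split => // i j.
  have -> : e = e / 2 + e / 2 by lra.
  apply: (@ball_triangle _ _ (r qv i j)).
    apply: ball_sym; apply: (@le_ball _ _ _ n.+1%:R^-1); last exact: wB.2.
    exact: ne'.
  apply: (@le_ball _ _ _ n.+1%:R^-1); last exact: xB.
  exact: ne'.
apply: countable_bigcupT_measurable; first exact: countableP.
by move=> p; case: ifP.
Qed.

Lemma mvec_continuous X (g : 'rV[R]_d -> R) : mvec X -> continuous g ->
  measurable_fun setT (g \o X).
Proof.
move=> mX cg; apply: (measurability _ (RGenOInfty.measurableE R)).
move=> _ [_ [a ->] <-]; rewrite setTI.
rewrite comp_preimage; apply: mvec_open => //.
by apply: open_comp => // x _; exact: cg.
Qed.

(** Lower semicontinuity makes the strict superlevel sets open, and these generate the Borel sets of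
    the extended reals. *)
Lemma mvec_lsc X (h : 'rV[R]_d -> \bar R) : mvec X -> closed_efun h ->
  measurable_fun setT (h \o X).
Proof.
move=> mX sh; apply: (measurability _ (ErealGenOInfty.measurableE R)).
move=> /= _ [_ [a ->]] <-; rewrite setTI comp_preimage; apply: mvec_open => //.
by rewrite preimage_itvoy; move/lower_semicontinuousP : sh; exact.
Qed.

Lemma mvecD X Y : mvec X -> mvec Y -> mvec (fun w => X w + Y w).
Proof.
move=> mX mY j; under eq_fun do rewrite mxE.
by apply: measurable_funD; [exact: mX|exact: mY].
Qed.

Lemma mvecZ a X : mvec X -> mvec (fun w => a *: X w).
Proof.
move=> mX j; under eq_fun do rewrite mxE.
by apply: measurable_funM => //; exact: mX.
Qed.

Lemma mvecN X : mvec X -> mvec (fun w => - X w).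
Proof. by move=> mX; under eq_fun do rewrite -scaleN1r; exact: mvecZ. Qed.

Lemma mvecB X Y : mvec X -> mvec Y -> mvec (fun w => X w - Y w).
Proof. by move=> mX mY; apply: mvecD => //; exact: mvecN. Qed.

Lemma mvec_cst x : mvec (fun=> x).
Proof. by move=> j; exact: measurable_cst. Qed.

Lemma mvec_lipschitz X (p : 'rV[R]_d -> 'rV[R]_d) (C : R) : mvec X ->
  (forall u v, sqn (p u - p v) <= C * sqn (u - v)) -> mvec (fun w => p (X w)).
Proof.
move=> mX lip j; apply: (@mvec_continuous X (fun x => p x 0 j)) => // x.
apply/(@cvgrPdist_le _ _ _ (nbhs x) (nbhs_filter x)) => e e0.
(* The factor [d] converts the sup norm of the topology into the squared Euclidean norm of the
   hypothesis; the added 1 keeps the divisor positive. *)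
pose K := `|C| * d%:R + 1.
have K0 : 0 < K by rewrite ltr_pwDr// mulr_ge0.
have r0 : 0 < Num.min 1 (e ^+ 2 / K) by rewrite lt_min ltr01 divr_gt0// exprn_gt0.
apply/nbhs_ballP; exists (Num.min 1 (e ^+ 2 / K)) => //= y [_ xy].
rewrite -(@ler_pXn2r _ 2)// ?nnegrE ?(ltW e0)//.
rewrite real_normK ?num_real//.
apply: (@le_trans _ _ (sqn (p x - p y))).
  by have := sqr_coord_le_sqn (p x - p y) j; rewrite !mxE.
apply: (le_trans (lip _ _)).
have sle : sqn (x - y) <= d%:R * (e ^+ 2 / K).
  rewrite /sqn /dotv -[d in d%:R]card_ord -sum1_card natr_sum mulr_suml.
  apply: ler_sum => i _; rewrite mul1r !mxE.
  have := xy 0 i; rewrite /ball/= lt_min => /andP[x1 x2].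
  rewrite -expr2 -real_normK ?num_real// expr2.
  apply: (@le_trans _ _ (1 * (e ^+ 2 / K))); last by rewrite mul1r.
  by apply: ler_pM => //; exact: ltW.
apply: (@le_trans _ _ (`|C| * (d%:R * (e ^+ 2 / K)))).
  apply: (@le_trans _ _ (`|C| * sqn (x - y))).
    by rewrite ler_wpM2r ?sqn_ge0// ler_norm.
  by rewrite ler_wpM2l.
have -> : `|C| * (d%:R * (e ^+ 2 / K)) = e ^+ 2 * (`|C| * d%:R / K) by ring.
by rewrite ler_piMr ?sqr_ge0// ler_pdivrMr// mul1r /K; lra.
Qed.

Lemma mvec_dotv X Y : mvec X -> mvec Y -> measurable_fun setT (fun w => dotv (X w) (Y w)).
Proof.
move=> mX mY; apply: measurable_sum => j.
by apply: measurable_funM; [exact: mX|exact: mY].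
Qed.

Lemma mvec_sqn X : mvec X -> measurable_fun setT (fun w => sqn (X w)).
Proof. by move=> mX; exact: mvec_dotv. Qed.

End MeasurableVector.

(** * Joint measurability of the stochastic gradient *)

Section Caratheodory.
Variables (R : realType) (d : nat) (dT dZ : measure_display).
Variables (T : measurableType dT) (Z : measurableType dZ).

(** [X] is rounded down to the grid of mesh [1 / (n + 1)]. The rounded vector takes countably many
    values, so the preimages are countable unions of rectangles, and continuity in the first
    argument gives pointwise convergence. *)
Lemma caratheodory_measurable (F : 'rV[R]_d -> Z -> R) (X : T -> 'rV[R]_d) :
  mvec X -> (forall z, continuous (F ^~ z)) ->
  (forall x, measurable_fun setT (F x)) ->
  measurable_fun setT (fun p : T * Z => F (X p.1) p.2).
Proof.
move=> mX cF mF.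
pose g (n : nat) (v : 'rV[int]_d) : 'rV[R]_d := \row_j ((v 0 j)%:~R / n.+1%:R).
pose fl (n : nat) (x : 'rV[R]_d) : 'rV[int]_d := \row_j Num.floor (n.+1%:R * x 0 j).
pose Fn (n : nat) (p : T * Z) := F (g n (fl n (X p.1))) p.2.
apply: (@measurable_fun_cvg _ _ _ setT Fn) => [n|[w z] _] /=; last first.
  apply: (@cvg_comp _ _ _ (fun n => g n (fl n (X w))) (F ^~ z)); last exact: cF.
  apply/cvgrPdist_lt => e e0.
  have : (fun n => n.+1%:R^-1 : R) @ \oo --> (0 : R) by exact: cvg_harmonic.
  move/cvgrPdist_lt => /(_ _ e0) [N _ HN].
  exists N => // n /HN /=; rewrite sub0r normrN ger0_norm ?invr_ge0// => ne.
  suff : ball (X w) e (g n (fl n (X w))) by rewrite mx_norm_ball.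
  split => // i j; rewrite ord1 /ball /= !mxE.
  apply: le_lt_trans ne.
  have n0 : 0 < n.+1%:R :> R by rewrite ltr0n.
  rewrite -(@ler_pM2l _ n.+1%:R)// divff ?gt_eqF//.
  rewrite -[X in X * `| _ |]ger0_norm ?ler0n// -normrM mulrBr [_ * (_ / _)]mulrC divfK ?gt_eqF//.
  have := floor_le (n.+1%:R * X w 0 j); have := lt_succ_floor (n.+1%:R * X w 0 j).
  by rewrite intrD1 => h1 h2; rewrite ger0_norm; lra.
move=> _ B mB; rewrite setTI.
rewrite (_ : _ @^-1` _ = \bigcup_(v in [set: 'rV[int]_d])
   ([set w | forall j, Num.floor (n.+1%:R * X w 0 j) = v 0 j] `*` (F (g n v) @^-1` B))).
  apply: countable_bigcupT_measurable; first exact: countableP.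
  move=> v; apply: measurableX.
    pose Y := fun w => n.+1%:R *: X w.
    rewrite (_ : mkset _ = [set w | forall j, `[(v 0 j)%:~R, (v 0 j)%:~R + 1[ (Y w 0 j)]).
      apply: (@measurable_coordwise _ _ _ _ Y (fun j => `[(v 0 j)%:~R, (v 0 j)%:~R + 1[%classic)) => //.
      exact: mvecZ.
    apply/seteqP; split => w /= H j; have := H j; rewrite /Y !mxE /= in_itv /=.
      by move=> <-; rewrite floor_le -intrD1 lt_succ_floor.
    by move=> H'; apply: floor_def; rewrite intrD1.
  by rewrite -[X in measurable X]setTI; exact: mF.
apply/seteqP; split => [[w z] /= H|[w z] [v _] [/= Hw Hz]].
  by exists (fl n (X w)) => //; split => //= j; rewrite mxE.
rewrite /Fn /= (_ : fl n (X w) = v)//.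
by apply/rowP => j; rewrite mxE; exact: Hw.
Qed.

(** A partial derivative is the limit of difference quotients of [F], each jointly measurable by the
    Caratheodory argument because a differentiable function is continuous. *)
Lemma gradient_measurable (F : 'rV[R]_d -> Z -> R) (gF : 'rV[R]_d -> Z -> 'rV[R]_d)
    (X : T -> 'rV[R]_d) (j : 'I_d) :
  mvec X -> (forall z, is_gradient (F ^~ z) (gF ^~ z)) ->
  (forall x, measurable_fun setT (F x)) ->
  measurable_fun setT (fun p : T * Z => gF (X p.1) p.2 0 j).
Proof.
move=> mX gradF mF.
have cF z : continuous (F ^~ z).
  by move=> x; have [dF _] := gradF z x; exact: (differentiable_continuous dF).
pose v : 'rV[R]_d := delta_mx 0 j.
apply: (@measurable_fun_cvg _ _ _ setT (fun n (p : T * Z) =>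
   n.+1%:R * (F (X p.1 + n.+1%:R^-1 *: v) p.2 - F (X p.1) p.2))) => [n|[w z] _] /=.
  apply: (@measurable_funM _ _ _ setT (cst n.+1%:R)) => //.
  apply: (@measurable_funB _ _ _ setT (fun p : T * Z => F (X p.1 + n.+1%:R^-1 *: v) p.2)
    (fun p => F (X p.1) p.2)).
    apply: (@caratheodory_measurable F (fun w => X w + n.+1%:R^-1 *: v)) => //.
    by apply: mvecD => //; exact: mvec_cst.
  by apply: (@caratheodory_measurable F X).
have := @is_gradient_cvg R d (F ^~ z) (gF ^~ z) (gradF z) (X w) v.
suff -> : dotv (gF (X w) z) v = gF (X w) z 0 j by [].
rewrite /dotv (bigD1 j)//= big1 => [|i ij].
  by rewrite mxE !eqxx mulr1 addr0.
by rewrite mxE (negbTE ij) andbF mulr0.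
Qed.

End Caratheodory.

(** * Square-integrable random vectors *)

Section SquareIntegrable.
Variables (R : realType) (dO : measure_display) (O : measurableType dO)
  (P : probability O R) (d : nat).
Implicit Types X Y : O -> 'rV[R]_d.

Lemma integrable_dominated (D : set O) (f g : O -> R) : measurable D ->
  measurable_fun setT f -> (forall w, D w -> `|f w| <= g w) ->
  P.-integrable D (EFin \o g) -> P.-integrable D (EFin \o f).
Proof.
move=> mD mf fg; apply: le_integrable => //.
  by apply/measurable_EFinP; exact: measurable_funTS.
by move=> w Dw /=; rewrite lee_fin (le_trans (fg _ Dw))// ler_norm.
Qed.

Lemma integrable_sumr (D : set O) I (s : seq I) (h : I -> O -> R) : measurable D ->
  (forall i, P.-integrable D (EFin \o h i)) ->
  P.-integrable D (EFin \o (fun w => \sum_(i <- s) h i w)).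
Proof.
move=> mD hi; rewrite (_ : _ \o _ = fun w => \sum_(i <- s) (h i w)%:E)%E.
  by apply: (@integrable_sum _ _ _ _ _ mD _ s xpredT (fun i => EFin \o h i)).
by apply/funext => w /=; rewrite sumEFin.
Qed.

Lemma Rintegral_sum_eq0 (D : set O) I (s : seq I) (h : I -> O -> R) : measurable D ->
  (forall i, P.-integrable D (EFin \o h i)) ->
  (forall i, \int[P]_(w in D) h i w = 0) ->
  \int[P]_(w in D) (\sum_(i <- s) h i w) = 0.
Proof.
move=> mD hi h0; elim: s => [|i s IH].
  rewrite (@eq_Rintegral _ _ _ _ D (cst 0)); last by move=> w _; rewrite big_nil.
  by rewrite Rintegral_cst// mul0r.
under eq_Rintegral do rewrite big_cons.
by rewrite RintegralD// ?h0 ?IH ?addr0//; exact: integrable_sumr.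
Qed.

Definition sqi X := mvec X /\ P.-integrable setT (EFin \o (fun w => sqn (X w))).

Lemma integrable_cst_prob (D : set O) (a : R) : measurable D ->
  P.-integrable D (EFin \o (fun=> a)).
Proof.
by move=> mD; apply: (integrableS measurableT) => //; exact: finite_measure_integrable_cst.
Qed.

Lemma sqi_le (a b : R) X Y : mvec Y ->
  (forall w, sqn (Y w) <= a * sqn (X w) + b) -> sqi X -> sqi Y.
Proof.
move=> mY YX [mX iX]; split => //.
apply: (@integrable_dominated _ _ (fun w => a * sqn (X w) + b)) => //.
- exact: mvec_sqn.
- by move=> w _; rewrite ger0_norm ?sqn_ge0.
rewrite (_ : _ \o _ = (fun w => a%:E * (sqn (X w))%:E)%E \+ (EFin \o (fun=> b)))//.
by apply: integrableD => //; [exact: integrableZl|exact: integrable_cst_prob].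
Qed.

Lemma sqi_cst x : sqi (fun=> x).
Proof. by split; [exact: mvec_cst|exact: integrable_cst_prob]. Qed.

Lemma sqiZ a X : sqi X -> sqi (fun w => a *: X w).
Proof.
move=> sX; apply: (sqi_le (a := a ^+ 2) (b := 0)) (sX); first by apply: mvecZ; case: sX.
by move=> w; rewrite sqnZ addr0.
Qed.

Lemma sqiD X Y : sqi X -> sqi Y -> sqi (fun w => X w + Y w).
Proof.
move=> [mX iX] [mY iY]; split; first exact: mvecD.
apply: (@integrable_dominated _ _ (fun w => 2 * sqn (X w) + 2 * sqn (Y w))) => //.
- by apply: mvec_sqn; exact: mvecD.
- by move=> w _; rewrite ger0_norm ?sqn_ge0// sqnD_le.
rewrite (_ : _ \o _ = (fun w => 2%:E * (sqn (X w))%:E)%E \+ (fun w => 2%:E * (sqn (Y w))%:E)%E)//.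
by apply: integrableD => //; exact: integrableZl.
Qed.

Lemma sqiN X : sqi X -> sqi (fun w => - X w).
Proof. by move=> sX; under eq_fun do rewrite -scaleN1r; exact: sqiZ. Qed.

Lemma sqiB X Y : sqi X -> sqi Y -> sqi (fun w => X w - Y w).
Proof. by move=> sX sY; apply: sqiD => //; exact: sqiN. Qed.

Lemma sqi_lipschitz (C : R) (p : 'rV[R]_d -> 'rV[R]_d) X :
  (forall u v, sqn (p u - p v) <= C * sqn (u - v)) -> sqi X -> sqi (fun w => p (X w)).
Proof.
move=> lip sX.
(* Subtracting the value at 0 turns the Lipschitz bound into growth controlled by [sqn (X w)]; the
   constant is integrable because [P] is finite. *)
have -> : (fun w => p (X w)) = fun w => (p (X w) - p 0) + p 0.
  by apply/funext => w; rewrite subrK.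
apply: sqiD; last exact: sqi_cst.
apply: (sqi_le (a := C) (b := 0)) (sX) => [|w]; last first.
  by rewrite addr0; have := lip (X w) 0; rewrite subr0.
apply: mvecB; last exact: mvec_cst.
by apply: mvec_lipschitz lip; case: sX.
Qed.

Lemma sqi_dotv X Y : sqi X -> sqi Y ->
  P.-integrable setT (EFin \o (fun w => dotv (X w) (Y w))).
Proof.
move=> [mX iX] [mY iY].
apply: (@integrable_dominated _ _ (fun w => sqn (X w) + sqn (Y w))) => //.
- exact: mvec_dotv.
- move=> w _; have := sqn_ge0 (X w + Y w); have := sqn_ge0 (X w - Y w).
  by rewrite sqnB sqnD ler_norml => h1 h2; apply/andP; split;
    have := sqn_ge0 (X w); have := sqn_ge0 (Y w); lra.
rewrite (_ : _ \o _ = (EFin \o (fun w => sqn (X w))) \+ (EFin \o (fun w => sqn (Y w))))//.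
exact: integrableD.
Qed.

Lemma sqi_coordM X Y l : sqi X -> sqi Y ->
  P.-integrable setT (EFin \o (fun w => X w 0 l * Y w 0 l)).
Proof.
move=> [mX iX] [mY iY].
apply: (@integrable_dominated _ _ (fun w => sqn (X w) + sqn (Y w))) => //.
- by apply: measurable_funM; [exact: mX|exact: mY].
- move=> w _; have := sqr_coord_le_sqn (X w) l; have := sqr_coord_le_sqn (Y w) l.
  have := sqr_ge0 (X w 0 l + Y w 0 l); have := sqr_ge0 (X w 0 l - Y w 0 l).
  rewrite sqrrB sqrrD ler_norml => h1 h2 h3 h4; have := sqr_ge0 (X w 0 l); have := sqr_ge0 (Y w 0 l).
  by move=> h5 h6; apply/andP; split; lra.
rewrite (_ : _ \o _ = (EFin \o (fun w => sqn (X w))) \+ (EFin \o (fun w => sqn (Y w))))//.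
exact: integrableD.
Qed.

Lemma sqi_coord X l : sqi X -> P.-integrable setT (EFin \o (fun w => X w 0 l)).
Proof.
move=> [mX iX].
apply: (@integrable_dominated _ _ (fun w => 1 + sqn (X w))) => //.
- move=> w _; have := sqr_coord_le_sqn (X w) l.
  have := sqr_ge0 (X w 0 l + 1); have := sqr_ge0 (X w 0 l - 1).
  rewrite sqrrB sqrrD expr1n mulr1 ler_norml => h1 h2 h3; have := sqr_ge0 (X w 0 l).
  by move=> h4; apply/andP; split; lra.
rewrite (_ : _ \o _ = (EFin \o (fun=> 1)) \+ (EFin \o (fun w => sqn (X w))))//.
by apply: integrableD => //; exact: integrable_cst_prob.
Qed.

(** This and the next lemma remove the randomness of the sample number: a statement about integrals
    is checked on each event [{N = n}] and recovered by countable additivity. *)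
Lemma integral_partition_eq0 (f : O -> R) (N : O -> nat) :
  (forall n, measurable (N @^-1` [set n])) -> P.-integrable setT (EFin \o f) ->
  (forall n, \int[P]_(w in N @^-1` [set n]) f w = 0) -> \int[P]_w f w = 0.
Proof.
move=> mN fi f0.
have UN : \bigcup_n (N @^-1` [set n]) = setT.
  by apply/seteqP; split => // w _; exists (N w).
rewrite /Rintegral -UN integral_bigcup//.
- rewrite eseries0// => n _ _.
  rewrite -[LHS]fineK ?f0//; first by rewrite -[fine _]/(Rintegral _ _ _) f0.
  by apply: integrable_fin_num => //; exact: (integrableS measurableT).
- by apply/trivIsetP => i j _ _ ij; apply/seteqP; split => // w [/= Ni Nj];
    move: ij; rewrite -Ni -Nj eqxx.
- by rewrite UN.
Qed.

Lemma le_integral_partition (f g : O -> R) (N : O -> nat) (A : set O) :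
  measurable A -> (forall n, measurable (N @^-1` [set n])) ->
  measurable_fun setT f -> measurable_fun setT g ->
  (forall w, 0 <= f w) -> (forall w, 0 <= g w) ->
  (forall n, \int[P]_(w in A `&` N @^-1` [set n]) (f w)%:E <=
             \int[P]_(w in A `&` N @^-1` [set n]) (g w)%:E)%E ->
  (\int[P]_(w in A) (f w)%:E <= \int[P]_(w in A) (g w)%:E)%E.
Proof.
move=> mA mN mf mg f0 g0 fg.
have UN : \bigcup_n (A `&` N @^-1` [set n]) = A.
  by apply/seteqP; split => [w [n _ []]//|w Aw]; exists (N w).
have mAN n : measurable (A `&` N @^-1` [set n]) by exact: measurableI.
have tAN : trivIset setT (fun n => A `&` N @^-1` [set n]).
  apply/trivIsetP => i j _ _ ij; apply/seteqP; split => // w [[_ /= Ni] [_ /= Nj]].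
  by move: ij; rewrite -Ni -Nj eqxx.
rewrite -UN !ge0_integral_bigcup//.
- apply: lee_nneseries => [n _ _|n _]; last exact: fg.
  by apply: integral_ge0 => w _; rewrite lee_fin.
all: try by apply/measurable_EFinP; exact: measurable_funTS.
all: by move=> w _; rewrite lee_fin.
Qed.

End SquareIntegrable.

(** * Jensen's inequality for the square of a conditional expectation *)

Section CondexpJensen.
Variables (R : realType) (dO : measure_display) (O : measurableType dO)
  (P : probability O R) (C : set (set O)).

(* On a piece where [Z] varies by less than [t], with [b] one of its values,
   [Z ^+ 2 <= 2 b Z - b ^+ 2 + t ^+ 2], whose integral is that of
   [2 b X - b ^+ 2 + t ^+ 2 <= X ^+ 2 + t ^+ 2]. *)
Lemma condexp_sqr_le (X Z : O -> R) (A : set O) : is_condexp P <<s C >> X Z ->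
  P.-integrable setT (EFin \o (fun w => X w ^+ 2)) -> <<s C >> A ->
  (\int[P]_(w in A) (Z w ^+ 2)%:E <= \int[P]_(w in A) (X w ^+ 2)%:E)%E.
Proof.
move=> [CM ZC iX iZ ZX] iX2 CA.
have mA := CM _ CA.
have mX : measurable_fun setT X by apply/measurable_EFinP; case/integrableP: iX.
have mZ : measurable_fun setT Z by apply/measurable_EFinP; case/integrableP: iZ.
apply/lee_addgt0Pr => e e0.
have [n ne] : exists n : nat, n.+1%:R^-1 < e.
  exists (Num.truncn e^-1); rewrite invf_plt ?posrE//.
  by rewrite truncnS_gt.
pose t : R := n.+1%:R^-1.
have n0 : 0 < n.+1%:R :> R by rewrite ltr0n.
have t0 : 0 < t by rewrite invr_gt0.
have t1 : t <= 1 by rewrite invf_le1// ler1n.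
(* [N] labels the cell of width [t] that contains [Z w]. The integer is coded by a natural number to
   fit the partition lemma, and the cells belong to the sub-sigma-algebra because [Z] is measurable
   for it. *)
pose N w := pickle (Num.floor (n.+1%:R * Z w)).
have CN m : <<s C >> (N @^-1` [set m]).
  have [->|/set0P[w0 w0m]] := eqVneq (N @^-1` [set m]) set0; first exact: sigma_algebra0.
  pose v := Num.floor (n.+1%:R * Z w0).
  rewrite (_ : _ @^-1` _ = Z @^-1` `[v%:~R / n.+1%:R, (v%:~R + 1) / n.+1%:R[).
    by apply: ZC; exact: measurable_itv.
  apply/seteqP; split => w /=.
    rewrite -w0m => /(pcan_inj pickleK) wv; rewrite in_itv/= ler_pdivrMr// ltr_pdivlMr//.
    by rewrite /v -wv mulrC floor_le -intrD1 lt_succ_floor.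
  rewrite in_itv/= ler_pdivrMr// ltr_pdivlMr// mulrC => H.
  by rewrite -w0m /N; congr pickle; apply: floor_def; rewrite intrD1.
(* As [P A <= 1], the constant [e] may be moved under the integral at a nonnegative surplus
   [e - e * P A]. The error is then pointwise and can be treated cell by cell. *)
have -> : (\int[P]_(w in A) (X w ^+ 2)%:E + e%:E =
  \int[P]_(w in A) (X w ^+ 2)%:E + \int[P]_(w in A) (cst e%:E w) +
    (e%:E - e%:E * P A))%E.
  rewrite integral_cst// -addeA; congr (_ + _)%E.
  by rewrite addeC subeK// fin_numM// fin_num_measure.
apply: (@le_trans _ _ (\int[P]_(w in A) (X w ^+ 2 + e)%:E)%E); last first.
  under eq_integral do rewrite EFinD.
  rewrite ge0_integralD//; first last.
  - by move=> w _; rewrite lee_fin ltW.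
  - by apply/measurable_EFinP; apply: measurable_funTS; exact: measurable_funX.
  - by move=> w _; rewrite lee_fin sqr_ge0.
  rewrite leeDl// sube_ge0; last by rewrite fin_numM// fin_num_measure.
  by rewrite -[leRHS]mule1 lee_wpmul2l ?probability_le1// lee_fin ltW.
apply: (@le_integral_partition _ _ _ _ _ _ N) => //.
- by move=> m; apply: CM; exact: CN.
- exact: measurable_funX.
- by apply: measurable_funD => //; exact: measurable_funX.
- by move=> w; exact: sqr_ge0.
- by move=> w; rewrite addr_ge0 ?sqr_ge0 ?ltW.
move=> m; set D := A `&` _.
have CD : <<s C >> D by apply: (@measurableI _ (g_sigma_algebraType C)) => //; exact: CN.
have mD := CM _ CD.
have [->|/set0P[w0 [_ w0m]]] := eqVneq D set0; first by rewrite !integral_set0.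
pose b := Z w0.
have ZD w : D w -> `|Z w - b| <= t.
  move=> [_ /=]; rewrite -w0m => /(pcan_inj pickleK) wv.
  rewrite -(@ler_pM2l _ n.+1%:R)// divff ?gt_eqF//.
  rewrite -[X in X * `| _ |]ger0_norm ?ler0n// -normrM mulrBr.
  have := floor_le (n.+1%:R * Z w); have := lt_succ_floor (n.+1%:R * Z w).
  have := floor_le (n.+1%:R * b); have := lt_succ_floor (n.+1%:R * b).
  rewrite -/b in wv; rewrite !intrD1 wv => h1 h2 h3 h4.
  by rewrite ler_norml; apply/andP; split; lra.
have Zb w : D w -> Z w ^+ 2 <= 2 * b * Z w + (t - b ^+ 2).
  move=> /ZD Zwb; have : (Z w - b) ^+ 2 <= t.
    rewrite -real_normK ?num_real//; apply: (@le_trans _ _ (t ^+ 2)).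
      by rewrite ler_pXn2r// nnegrE// ltW.
    by rewrite expr2 ler_piMl// ltW.
  by rewrite sqrrB; lra.
have iXD := integrableS measurableT mD (@subsetT _ D) iX.
have iZD := integrableS measurableT mD (@subsetT _ D) iZ.
have iX2D := integrableS measurableT mD (@subsetT _ D) iX2.
have ib (Y : O -> R) : P.-integrable D (EFin \o Y) ->
    P.-integrable D (EFin \o (fun w => 2 * b * Y w)) by move=> iY; exact: (@integrableZl _ _ _ _ _ mD (2 * b) (EFin \o Y) iY).
have iL (Y : O -> R) : P.-integrable D (EFin \o Y) ->
    P.-integrable D (EFin \o (fun w => 2 * b * Y w + (t - b ^+ 2))).
  move=> iY; rewrite (_ : _ \o _ = (EFin \o (fun w => 2 * b * Y w)) \+
    (EFin \o (fun=> t - b ^+ 2)))//.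
  by apply: integrableD => //; [exact: ib|exact: integrable_cst_prob].
have iX2e : P.-integrable D (EFin \o (fun w => X w ^+ 2 + e)).
  rewrite (_ : _ \o _ = (EFin \o (fun w => X w ^+ 2)) \+ (EFin \o (fun=> e)))//.
  by apply: integrableD => //; exact: integrable_cst_prob.
have iZ2D : P.-integrable D (EFin \o (fun w => Z w ^+ 2)).
  apply: integrable_dominated (iL _ iZD) => //; first exact: measurable_funX.
  by move=> w Dw; rewrite ger0_norm ?sqr_ge0// Zb.
rewrite -[leLHS]fineK ?integrable_fin_num// -[leRHS]fineK ?integrable_fin_num//.
rewrite lee_fin.
apply: (@le_trans _ _ (\int[P]_(w in D) (2 * b * Z w + (t - b ^+ 2)))).
  by apply: le_Rintegral => //; exact: iL.
have -> : \int[P]_(w in D) (2 * b * Z w + (t - b ^+ 2)) =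
          \int[P]_(w in D) (2 * b * X w + (t - b ^+ 2)).
  rewrite !RintegralD// ?RintegralZl//; try exact: ib; try exact: integrable_cst_prob.
  by congr (_ * _ + _); rewrite /Rintegral ZX.
apply: le_Rintegral => //; first exact: iL.
move=> w _; have := sqr_ge0 (X w - b); rewrite sqrrB /t => h; move: ne.
by rewrite -/t => ne; lra.
Qed.

End CondexpJensen.

(** * Sampling independently of the past *)

Section SubSigmaAlgebra.
Variables (R : realType) (dO : measure_display) (O : measurableType dO)
  (C : set (set O)).
Let OC : measurableType _ := g_sigma_algebraType C.
Hypothesis CM : <<s C >> `<=` measurable.

Lemma measurable_fun_sub d' (U : measurableType d') (f : O -> U) :
  measurable_fun (setT : set OC) f -> measurable_fun (setT : set O) f.
Proof. by move=> mf _ B mB; apply: CM; exact: mf. Qed.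

Lemma mvec_sub d (X : O -> 'rV[R]_d) : mvec (X : OC -> 'rV[R]_d) -> mvec X.
Proof. by move=> mX j; apply: measurable_fun_sub; exact: mX. Qed.

(** The identity into the coarser space is the random element that represents the whole past;
    pairing it with a sample yields a joint law to which Fubini applies. *)
Lemma measurable_sub_id : measurable_fun setT (fun w : O => w : OC).
Proof. by move=> _ B mB; rewrite setTI; exact: CM. Qed.

Lemma measurable_sub_graph d' (U : measurableType d') (xi : O -> U) :
  measurable_fun setT xi -> measurable_fun setT (fun w : O => (w : OC, xi w)).
Proof. by move=> mxi; apply: measurable_fun_pair => //; exact: measurable_sub_id. Qed.

End SubSigmaAlgebra.

Section Freezing.
Variables (R : realType) (dO : measure_display) (O : measurableType dO)
  (P : probability O R) (dX : measure_display) (Xi : measurableType dX)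
  (Pxi : probability Xi R) (C : set (set O)) (xi : O -> Xi).
Let OC : measurableType _ := g_sigma_algebraType C.
Hypothesis CM : <<s C >> `<=` measurable.
Hypothesis mxi : measurable_fun setT xi.
Hypothesis xilaw : forall B, measurable B -> P (xi @^-1` B) = Pxi B.
Hypothesis xiind : forall A B, <<s C >> A -> measurable B ->
  P (A `&` xi @^-1` B) = (P A * P (xi @^-1` B))%E.

Let idC (w : O) : OC := w.
Let gr (w : O) : OC * Xi := (idC w, xi w).
Let mgr : measurable_fun setT gr := measurable_sub_graph CM mxi.
Let idC_mfun : {mfun O >-> OC} :=
  HB.pack idC (isMeasurableFun.Build _ _ _ _ _ (measurable_sub_id CM)).
Let gr_mfun : {mfun O >-> (OC * Xi)%type} :=
  HB.pack gr (isMeasurableFun.Build _ _ _ _ _ mgr).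
Let Q := distribution P idC_mfun.

(** Independence is the product formula on rectangles, and a product measure is determined by its
    rectangles. *)
Let joint_law (S : set (OC * Xi)) : measurable S ->
  (Q \x Pxi)%E S = distribution P gr_mfun S.
Proof.
apply: product_measure_unique => A B mA mB.
rewrite /= /Q /distribution /pushforward /=.
by rewrite -xilaw// -xiind.
Qed.

(** The sample may be integrated first with the past held fixed: this is Tonelli's theorem for the
    product law of past and sample. *)
Lemma freezing_ge0 (psi : OC * Xi -> \bar R) : measurable_fun setT psi ->
  (forall p, 0 <= psi p)%E ->
  (\int[P]_w psi (w, xi w) = \int[P]_w \int[Pxi]_z psi (w, z))%E.
Proof.
move=> mpsi psi0.
have -> : (\int[P]_w psi (w, xi w) = \int[distribution P gr_mfun]_p psi p)%E.
  by rewrite ge0_integral_distribution.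
rewrite (eq_measure_integral (Q \x Pxi)%E); last first.
  by move=> S mS _; exact/esym/joint_law.
rewrite fubini_tonelli1// /Q ge0_integral_distribution//.
- exact: measurable_fun_fubini_tonelli_F.
- by move=> w; exact: integral_ge0.
Qed.

(** This is the signed version, through Fubini's theorem. Integrability is assumed along the sample
    path and transported to the product law, where the inner integral vanishes identically. *)
Lemma freezing_eq0 (psi : OC * Xi -> R) : measurable_fun setT psi ->
  P.-integrable setT (EFin \o (fun w => psi (w, xi w))) ->
  (forall w, \int[Pxi]_z (psi (w, z))%:E = 0)%E ->
  (\int[P]_w (psi (w, xi w))%:E = 0)%E.
Proof.
move=> mpsi ipsi psi0.
have mE : measurable_fun setT (EFin \o psi) by exact/measurable_EFinP.
have igr : (distribution P gr_mfun).-integrable setT (EFin \o psi).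
  by apply: (@integrable_pushforward _ _ _ _ _ gr mgr P setT (EFin \o psi)).
have -> : (\int[P]_w (psi (w, xi w))%:E = \int[distribution P gr_mfun]_p (psi p)%:E)%E.
  by rewrite (@integral_distribution _ _ _ _ _ _ gr_mfun (EFin \o psi)).
rewrite (eq_measure_integral (Q \x Pxi)%E); last first.
  by move=> S mS _; exact/esym/joint_law.
rewrite -(@integral12_prod_meas1 _ _ _ _ _ Q Pxi (EFin \o psi)).
  by apply: integral0_eq => w _; rewrite /fubini_F; exact: psi0.
apply/integrableP; split => //; case/integrableP : igr => _ ioo.
rewrite (eq_measure_integral (distribution P gr_mfun))//.
by move=> S mS _; exact: joint_law.
Qed.

End Freezing.

Section JointSigmaAlgebra.
Variables (R : realType) (dO : measure_display) (O : measurableType dO)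
  (P : probability O R) (dX : measure_display) (Xi : measurableType dX)
  (C : set (set O)) (xi1 xi2 : O -> Xi).
Hypothesis CM : <<s C >> `<=` measurable.
Hypotheses (mxi1 : measurable_fun setT xi1) (mxi2 : measurable_fun setT xi2).

(** These rectangles form a pi-system generating the sigma-algebra of the past together with [xi1].
    It allows one sample to count as past while another is integrated. *)
Definition joint_sys : set (set O) :=
  [set E | exists A B, [/\ <<s C >> A, measurable B & E = A `&` xi1 @^-1` B]].

Lemma joint_sys_measurable : <<s joint_sys >> `<=` measurable.
Proof.
apply: smallest_sub; first exact: sigma_algebra_measurable.
move=> _ [A [B [CA mB ->]]]; apply: measurableI; first exact: CM.
by rewrite -[X in measurable X]setTI; exact: mxi1.
Qed.

Lemma sub_joint_sys : <<s C >> `<=` <<s joint_sys >>.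
Proof.
move=> A CA; apply: sub_sigma_algebra; exists A, setT; split => //.
by rewrite preimage_setT setIT.
Qed.

Lemma joint_sys_preimage B : measurable B -> <<s joint_sys >> (xi1 @^-1` B).
Proof.
move=> mB; apply: sub_sigma_algebra; exists setT, B; split => //.
  exact: (@measurableT _ (g_sigma_algebraType C)).
by rewrite setTI.
Qed.

Hypothesis ind3 : forall A B1 B2, <<s C >> A -> measurable B1 -> measurable B2 ->
  P (A `&` xi1 @^-1` B1 `&` xi2 @^-1` B2) =
  (P (A `&` xi1 @^-1` B1) * P (xi2 @^-1` B2))%E.

(** For fixed [B] both sides are finite measures in [E]; they agree on the pi-system by [ind3],
    hence on the sigma-algebra it generates. *)
Lemma joint_sys_indep E B : <<s joint_sys >> E -> measurable B ->
  P (E `&` xi2 @^-1` B) = (P E * P (xi2 @^-1` B))%E.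
Proof.
move=> CE mB.
have mB' : measurable (xi2 @^-1` B) by rewrite -[X in measurable X]setTI; exact: mxi2.
have p0 : 0 <= fine (P (xi2 @^-1` B)) by exact: fine_ge0.
pose m1 := mrestr P mB'.
pose m2 := mscale (NngNum p0) P.
suff : m1 E = m2 E.
  by rewrite /m1 /m2 /mrestr /mscale /= fineK ?fin_num_measure// muleC.
apply: (@g_sigma_algebra_measure_unique _ R O joint_sys _ (fun=> setT) _ _ m1 m2) => //.
- exact: subset_trans (@sub_sigma_algebra _ _ _) joint_sys_measurable.
- move=> _; exists setT, setT; split => //.
    exact: (@measurableT _ (g_sigma_algebraType C)).
  by rewrite preimage_setT setIT.
- by apply/seteqP; split => // w _; exists 0%N.
- move=> _ _ [A1 [B1 [C1 mB1 ->]]] [A2 [B2 [C2 mB2 ->]]].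
  exists (A1 `&` A2), (B1 `&` B2); split.
  + exact: (@measurableI _ (g_sigma_algebraType C)).
  + exact: measurableI.
  + by rewrite preimage_setI setIACA.
- move=> _ [A1 [B1 [C1 mB1 ->]]].
  have e : (P (A1 `&` xi1 @^-1` B1 `&` xi2 @^-1` B) =
      (fine (P (xi2 @^-1` B)))%:E * P (A1 `&` xi1 @^-1` B1))%E.
    by rewrite fineK ?fin_num_measure// ind3// muleC.
  exact: e.
- move=> k; have e : (P (setT `&` xi2 @^-1` B) < +oo)%E.
    by rewrite setTI ltey_eq fin_num_measure.
  exact: e.
Qed.

End JointSigmaAlgebra.

(** * Mean, variance and correlation of single-sample deviations *)

Section Deviation.
Variables (R : realType) (d : nat) (dO : measure_display) (O : measurableType dO)
  (P : probability O R) (dX : measure_display) (Xi : measurableType dX)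
  (Pxi : probability Xi R).
Variables (F : 'rV[R]_d -> Xi -> R) (gF : 'rV[R]_d -> Xi -> 'rV[R]_d)
  (gf : 'rV[R]_d -> 'rV[R]_d) (Lsq : R).
Hypothesis gradF : forall z, is_gradient (F ^~ z) (gF ^~ z).
Hypothesis mF : forall x, measurable_fun setT (F x).
Hypothesis unb : forall x (j : 'I_d), Pxi.-integrable setT (fun z => (gF x z 0 j)%:E) /\
  (\int[Pxi]_(z in setT) (gF x z 0 j)%:E)%E = (gf x 0 j)%:E.
Hypothesis lipgf : forall u v, sqn (gf u - gf v) <= Lsq * sqn (u - v).

Definition dev (y : O -> 'rV[R]_d) (xi : O -> Xi) (w : O) := gF (y w) (xi w) - gf (y w).

Lemma dev_joint_measurable (dT : measure_display) (T : measurableType dT)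
    (y : T -> 'rV[R]_d) l : mvec y ->
  measurable_fun setT (fun p : T * Xi => gF (y p.1) p.2 0 l - gf (y p.1) 0 l).
Proof.
move=> my.
apply: (@measurable_funB _ _ _ setT (fun p : T * Xi => gF (y p.1) p.2 0 l)
  (fun p => gf (y p.1) 0 l)); first exact: (gradient_measurable l my gradF mF).
apply: (@measurableT_comp _ _ _ _ _ _ (fun w => gf (y w) 0 l) _ fst) => //.
exact: (mvec_lipschitz my lipgf).
Qed.

Lemma dev_measurable (C : set (set O)) y xi : <<s C >> `<=` measurable ->
  mvec (y : g_sigma_algebraType C -> _) -> measurable_fun setT xi -> mvec (dev y xi).
Proof.
move=> CM my mxi l; rewrite /dev; under eq_fun do rewrite !mxE.
exact: (measurableT_comp (dev_joint_measurable l my) (measurable_sub_graph CM mxi)).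
Qed.

Section OneSample.
Variables (C : set (set O)) (xi : O -> Xi) (y : O -> 'rV[R]_d).
Let OC : measurableType _ := g_sigma_algebraType C.
Hypothesis CM : <<s C >> `<=` measurable.
Hypothesis mxi : measurable_fun setT xi.
Hypothesis xilaw : forall B, measurable B -> P (xi @^-1` B) = Pxi B.
Hypothesis xiind : forall A B, <<s C >> A -> measurable B ->
  P (A `&` xi @^-1` B) = (P A * P (xi @^-1` B))%E.
Hypothesis my : mvec (y : OC -> _).

(** With the past frozen, [a] is a constant factor and the deviation integrates to zero by
    unbiasedness of [gF]. *)
Lemma dev_mean0 (a : O -> R) l : measurable_fun (setT : set OC) a ->
  P.-integrable setT (EFin \o (fun w => a w * dev y xi w 0 l)) ->
  \int[P]_w (a w * dev y xi w 0 l) = 0.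
Proof.
move=> ma ia; rewrite /Rintegral.
pose psi (p : OC * Xi) := a p.1 * (gF (y p.1) p.2 0 l - gf (y p.1) 0 l).
have mpsi : measurable_fun setT psi.
  apply: (@measurable_funM _ _ _ setT (fun p : OC * Xi => a p.1)
    (fun p => gF (y p.1) p.2 0 l - gf (y p.1) 0 l)).
    exact: (@measurableT_comp _ _ _ (OC * Xi)%type OC _ a setT fst ma measurable_fst).
  exact: dev_joint_measurable.
have E w : a w * dev y xi w 0 l = psi (w, xi w) by rewrite /dev !mxE.
under eq_integral do rewrite E.
rewrite (@freezing_eq0 _ _ _ P _ _ Pxi C xi CM mxi xilaw xiind psi mpsi)//.
  rewrite (_ : EFin \o _ = EFin \o (fun w => a w * dev y xi w 0 l))//.
  by apply/funext => w /=; rewrite E.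
move=> w; have [iu Eu] := unb (y w) l.
rewrite /psi/=; under eq_integral do rewrite EFinM EFinB.
rewrite integralZl//; last first.
  by apply: integrableB => //; exact: (integrable_cst_prob Pxi).
rewrite integralB//; last exact: (integrable_cst_prob Pxi).
rewrite Eu integral_cst// [X in (_ - _ * X)%E](_ : _ = 1%E).
  by rewrite mule1 subee// mule0.
exact: probability_setT.
Qed.

Lemma dev_sqn_le (A : set O) (v : R) : <<s C >> A -> 0 <= v ->
  {ae P, forall w, (\int[Pxi]_z (sqn (gF (y w) z - gf (y w)))%:E <= v%:E)%E} ->
  (\int[P]_(w in A) (sqn (dev y xi w))%:E <= v%:E * P A)%E.
Proof.
move=> CA v0 aev; have mA := CM CA.
pose S (p : OC * Xi) : \bar R := (sqn (gF (y p.1) p.2 - gf (y p.1)))%:E.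
have mS : measurable_fun setT S.
  apply/measurable_EFinP; apply: mvec_sqn => l.
  under eq_fun do rewrite !mxE.
  exact: dev_joint_measurable.
have S0 p : (0 <= S p)%E by rewrite lee_fin sqn_ge0.
pose I (w : OC) : \bar R := (\1_A w)%:E.
have mI : measurable_fun setT I.
  by apply/measurable_EFinP; apply: measurable_indic.
have I0 w : (0 <= I w)%E by rewrite lee_fin.
pose psi (p : OC * Xi) : \bar R := (I p.1 * S p)%E.
have mpsi : measurable_fun setT psi.
  apply: emeasurable_funM => //.
  exact: (@measurableT_comp _ _ _ (OC * Xi)%type OC _ I setT fst mI measurable_fst).
have indicM (f : O -> \bar R) : (\int[P]_(w in A) f w = \int[P]_w (I w * f w))%E.
  rewrite integral_mkcond; apply: eq_integral => w _; rewrite /patch /I indicE.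
  by case: ifP; rewrite ?mul1e ?mul0e.
rewrite indicM.
rewrite (@freezing_ge0 _ _ _ P _ _ Pxi C xi CM mxi xilaw xiind psi mpsi); last first.
  by move=> p; rewrite mule_ge0.
have mSw w : measurable_fun setT (fun z => S (w, z)).
  by apply: measurableT_comp => //; exact: measurable_pair1.
have -> : (\int[P]_w \int[Pxi]_z psi (w, z) = \int[P]_w (I w * \int[Pxi]_z S (w, z)))%E.
  by apply: eq_integral => w _; rewrite /psi/= ge0_integralZl//.
have mIS : measurable_fun (setT : set OC) (fun w => \int[Pxi]_z S (w, z))%E.
  exact: (@measurable_fun_fubini_tonelli_F _ _ OC Xi R Pxi S).
have mIO : measurable_fun (setT : set O) I := measurable_fun_sub CM mI.
have mISO : measurable_fun (setT : set O) (fun w => \int[Pxi]_z S (w, z))%E :=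
  measurable_fun_sub CM mIS.
apply: (@le_trans _ _ (\int[P]_w (I w * (cst v%:E w)))%E).
  apply: ae_ge0_le_integral => //.
  - by move=> w _; rewrite mule_ge0//; exact: integral_ge0.
  - exact: emeasurable_funM.
  - by move=> w _; rewrite mule_ge0// lee_fin.
  - exact: emeasurable_funM.
  - by apply: filterS aev => w Hw _; exact: lee_wpmul2l.
by rewrite -indicM integral_cst.
Qed.

End OneSample.

(** The past is enlarged by [xi1]. Then the indicator of [A] times the first deviation is a
    past-measurable weight, [xi2] is independent of the enlarged past, and [dev_mean0] applies. *)
Lemma dev_uncorrelated (C : set (set O)) (xi1 xi2 : O -> Xi) y (A : set O) l :
  <<s C >> `<=` measurable -> measurable_fun setT xi1 -> measurable_fun setT xi2 ->
  (forall B, measurable B -> P (xi2 @^-1` B) = Pxi B) ->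
  (forall A B1 B2, <<s C >> A -> measurable B1 -> measurable B2 ->
    P (A `&` xi1 @^-1` B1 `&` xi2 @^-1` B2) =
    (P (A `&` xi1 @^-1` B1) * P (xi2 @^-1` B2))%E) ->
  mvec (y : g_sigma_algebraType C -> _) -> <<s C >> A ->
  sqi P (dev y xi1) -> sqi P (dev y xi2) ->
  \int[P]_(w in A) (dev y xi1 w 0 l * dev y xi2 w 0 l) = 0.
Proof.
move=> CM m1 m2 law2 ind3 my CA s1 s2.
pose C' := joint_sys C xi1.
have CM' := joint_sys_measurable CM m1.
have sC := @sub_joint_sys _ _ _ _ C xi1.
have m1' : measurable_fun (setT : set (g_sigma_algebraType C')) xi1.
  by move=> _ B mB; rewrite setTI; exact: joint_sys_preimage.
have my' : mvec (y : g_sigma_algebraType C' -> _).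
  by move=> j _ B mB; apply: sC; exact: my.
have md1 : mvec (dev y xi1 : g_sigma_algebraType C' -> _).
  move=> j; rewrite /dev; under eq_fun do rewrite !mxE.
  exact: (measurableT_comp (dev_joint_measurable j my)
    (@measurable_sub_graph _ (g_sigma_algebraType C') C sC _ _ _ m1')).
pose a w := \1_A w * dev y xi1 w 0 l.
have ma : measurable_fun (setT : set (g_sigma_algebraType C')) a.
  apply: measurable_funM; last exact: md1.
  by apply: measurable_indic; exact: sC.
have mA := CM _ CA.
have E : (fun w => dev y xi1 w 0 l * dev y xi2 w 0 l) \_ A =
    fun w => a w * dev y xi2 w 0 l.
  apply/funext => w; rewrite /patch /a indicE.
  by case: ifP; rewrite ?mul1r ?mul0r.
rewrite Rintegral_mkcond E.
apply: (@dev_mean0 C' xi2 y CM' m2 law2 _ my' a l ma).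
  by move=> S B CS mB; exact: (joint_sys_indep CM m1 m2 ind3).
rewrite -E -restrict_EFin; apply/(integrable_mkcond _ mA).
by apply: (integrableS measurableT) => //; exact: sqi_coordM.
Qed.

End Deviation.

Lemma Rintegral_sqn_sum_le (R : realType) (d : nat) (dO : measure_display)
    (O : measurableType dO) (P : probability O R) (X : nat -> O -> 'rV[R]_d)
    (D : set O) (v : R) (n : nat) : measurable D ->
  (forall i, sqi P (X i)) -> (forall i, \int[P]_(w in D) sqn (X i w) <= v) ->
  (forall i j l, (i < j)%N -> \int[P]_(w in D) (X i w 0 l * X j w 0 l) = 0) ->
  sqi P (fun w => \sum_(i < n) X i w) /\
  \int[P]_(w in D) sqn (\sum_(i < n) X i w) <= n%:R * v.
Proof.
move=> mD sX vX cX; elim: n => [|n [sS IH]].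
  split; first by under eq_fun do rewrite big_ord0; exact: sqi_cst.
  rewrite (@eq_Rintegral _ _ _ _ D (cst 0)).
    by rewrite Rintegral_cst// !mul0r.
  by move=> w _; rewrite big_ord0 /sqn /dotv big1// => i _; rewrite mxE mul0r.
split; first by under eq_fun do rewrite big_ord_recr; exact: sqiD.
have iD (f : O -> R) : P.-integrable setT (EFin \o f) -> P.-integrable D (EFin \o f).
  by apply: integrableS.
have c0 : \int[P]_(w in D) dotv (\sum_(i < n) X i w) (X n w) = 0.
  rewrite (_ : (fun w => dotv _ _) = fun w => \sum_(p : 'I_n * 'I_d) (X p.1 w 0 p.2 * X n w 0 p.2)).
    apply: Rintegral_sum_eq0 => //.
      by move=> p; apply: iD; exact: sqi_coordM.
    by move=> p; exact: cX.
  apply/funext => w; rewrite -(pair_bigA _ (fun (i : 'I_n) (l : 'I_d) => X i w 0 l * X n w 0 l))/=.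
  rewrite exchange_big; apply: eq_bigr => l _ /=.
  by rewrite summxE mulr_suml.
have E : {in D, (fun w => sqn (\sum_(i < n.+1) X i w)) =1
    (fun w => (sqn (\sum_(i < n) X i w) + 2 * dotv (\sum_(i < n) X i w) (X n w)) + sqn (X n w))}.
  by move=> w _; rewrite big_ord_recr/= sqnD.
have i1 := iD _ sS.2.
have i2 := iD _ (sqi_dotv sS (sX n)).
have i2' : P.-integrable D (EFin \o (fun w => 2 * dotv (\sum_(i < n) X i w) (X n w))).
  exact: (integrableZl mD 2 i2).
have i3 := iD _ (sX n).2.
rewrite (eq_Rintegral _ E) RintegralD//; last first.
  by rewrite (_ : _ \o _ = (EFin \o (fun w => sqn (\sum_(i < n) X i w))) \+
    (EFin \o (fun w => 2 * dotv (\sum_(i < n) X i w) (X n w))))//; exact: integrableD.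
rewrite RintegralD// RintegralZl// c0 mulr0 addr0 -natr1 mulrDl mul1r.
exact: lerD.
Qed.

Lemma measurable_nat_partition (R : realType) (dO : measure_display)
    (O : measurableType dO) (N : O -> nat) (g : nat -> R) :
  (forall n, measurable (N @^-1` [set n])) -> measurable_fun setT (g \o N).
Proof.
move=> mN _ B mB; rewrite setTI.
rewrite (_ : _ @^-1` _ = \bigcup_(n in [set n | B (g n)]) (N @^-1` [set n])).
  by apply: bigcup_measurable.
by apply/seteqP; split => [w Bw|w [n Bn /= ->]//]; exists (N w).
Qed.

(** * The average of a random, past-measurable number of samples *)

Section SampleMean.
Variables (R : realType) (d : nat) (dO : measure_display) (O : measurableType dO)
  (P : probability O R) (dX : measure_display) (Xi : measurableType dX)
  (Pxi : probability Xi R).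
Variables (F : 'rV[R]_d -> Xi -> R) (gF : 'rV[R]_d -> Xi -> 'rV[R]_d)
  (gf : 'rV[R]_d -> 'rV[R]_d) (Lsq : R).
Hypothesis gradF : forall z, is_gradient (F ^~ z) (gF ^~ z).
Hypothesis mF : forall x, measurable_fun setT (F x).
Hypothesis unb : forall x (j : 'I_d), Pxi.-integrable setT (fun z => (gF x z 0 j)%:E) /\
  (\int[Pxi]_(z in setT) (gF x z 0 j)%:E)%E = (gf x 0 j)%:E.
Hypothesis lipgf : forall u v, sqn (gf u - gf v) <= Lsq * sqn (u - v).
Variables (C : set (set O)) (xi : nat -> O -> Xi) (y g : O -> 'rV[R]_d)
  (N : O -> nat) (v : R).
Let OC : measurableType _ := g_sigma_algebraType C.
Hypothesis CM : <<s C >> `<=` measurable.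
Hypothesis mxi : forall j, measurable_fun setT (xi j).
Hypothesis xilaw : forall j B, measurable B -> P (xi j @^-1` B) = Pxi B.
Hypothesis xiind : mutual_indep P (fun i : option nat =>
  match i with None => <<s C >> | Some j => [set xi j @^-1` B | B in measurable] end).
Hypothesis my : mvec (y : OC -> _).
Hypothesis mg : mvec g.
Hypothesis CN : forall n, <<s C >> (N @^-1` [set n]).
Hypothesis N0 : forall w, (0 < N w)%N.
Hypothesis gE : forall w, g w = (N w)%:R^-1 *: \sum_(j < N w) gF (y w) (xi j w).
Hypothesis v0 : 0 <= v.
Hypothesis varV : {ae P, forall w,
  (\int[Pxi]_z (sqn (gF (y w) z - gf (y w)))%:E <= v%:E)%E}.

Let mxiB j B : measurable B -> measurable (xi j @^-1` B).
Proof. by move=> mB; rewrite -[X in measurable X]setTI; exact: mxi. Qed.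

Let ind2 j A B : <<s C >> A -> measurable B ->
  P (A `&` xi j @^-1` B) = (P A * P (xi j @^-1` B))%E.
Proof.
move=> CA mB.
have := xiind (J := [:: None; Some j])
  (A := fun i => if i is None then A else xi j @^-1` B).
rewrite !big_cons !big_nil setIT mulr1 EFinM !fineK; last 2 first.
- by rewrite fin_num_measure//; exact: mxiB.
- by rewrite fin_num_measure//; exact: CM.
by apply => //= -[k|//]; rewrite !inE /= => /eqP[->]; exists B.
Qed.

Let ind3 i j A B1 B2 : i != j -> <<s C >> A -> measurable B1 -> measurable B2 ->
  P (A `&` xi i @^-1` B1 `&` xi j @^-1` B2) =
  (P (A `&` xi i @^-1` B1) * P (xi j @^-1` B2))%E.
Proof.
move=> ij CA mB1 mB2.
have := xiind (J := [:: None; Some i; Some j])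
  (A := fun k => if k is Some k' then (if k' == i then xi i @^-1` B1 else xi j @^-1` B2) else A).
rewrite !big_cons !big_nil eqxx eq_sym (negbTE ij) setIT mulr1 !EFinM !fineK; last 3 first.
- by rewrite fin_num_measure//; exact: mxiB.
- by rewrite fin_num_measure//; exact: mxiB.
- by rewrite fin_num_measure//; exact: CM.
rewrite setIA (@ind2 i A B1)// -muleA; apply.
  by rewrite /= !inE /= andbT; apply: contra ij => /eqP[->].
move=> [k|//]; rewrite !inE /= => /orP[] /eqP[->].
  by rewrite eqxx; exists B1.
by rewrite eq_sym (negbTE ij); exists B2.
Qed.

Let X j := dev gF gf y (xi j).

Let mX j : mvec (X j).
Proof. exact: (dev_measurable gradF mF lipgf CM my). Qed.

Let X_le j A : <<s C >> A -> (\int[P]_(w in A) (sqn (X j w))%:E <= v%:E * P A)%E.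
Proof.
move=> CA.
exact: (@dev_sqn_le _ _ _ _ P _ _ Pxi F gF gf Lsq gradF mF lipgf C (xi j) y CM
  (mxi j) (@xilaw j) (@ind2 j) my).
Qed.

Let sqiX j : sqi P (X j).
Proof.
split=> //; apply/integrableP; split.
  by apply/measurable_EFinP; exact: mvec_sqn.
under eq_integral => w _ do rewrite /= ger0_norm ?sqn_ge0//.
apply: le_lt_trans (X_le j _) _; first exact: (@measurableT _ OC).
by rewrite probability_setT mule1 ltry.
Qed.

Let errE n w : N w = n -> g w - gf (y w) = n%:R^-1 *: \sum_(j < n) X j w.
Proof.
move=> Nn; have n0 : n%:R != 0 :> R by rewrite pnatr_eq0 -lt0n -Nn.
rewrite gE Nn /X /dev sumrB scalerBr sumr_const card_ord.
by rewrite -[gf (y w) *+ n]scaler_nat scalerA mulVf// scale1r.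
Qed.

Let mN n : measurable (N @^-1` [set n]).
Proof. exact: CM. Qed.

Let merr : mvec (fun w => g w - gf (y w)).
Proof.
apply: mvecB => //; apply: (mvec_sub CM).
exact: (mvec_lipschitz my lipgf).
Qed.

(** On [{N = n}] the error is the average of a fixed number of uncorrelated deviations, so its
    variance is at most [v / n]. The event belongs to the past, which keeps the samples independent
    of it. *)
Lemma sample_mean_var A : <<s C >> A ->
  (\int[P]_(w in A) (sqn (g w - gf (y w)))%:E <= \int[P]_(w in A) (v / (N w)%:R)%:E)%E.
Proof.
move=> CA; have mA := CM CA.
apply: (@le_integral_partition _ _ _ _ _ _ N) => //.
- exact: mvec_sqn.
- exact: (@measurable_nat_partition _ _ _ N (fun n => v / n%:R)).
- by move=> w; exact: sqn_ge0.
- by move=> w; rewrite divr_ge0.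
move=> n; set D := A `&` _.
have CD : <<s C >> D by apply: (@measurableI _ OC) => //; exact: CN.
have mD := CM CD.
have [->|/set0P[w0 [_ w0n]]] := eqVneq D set0; first by rewrite !integral_set0.
have n0 : (0 < n)%N by rewrite -w0n.
have nR : 0 < n%:R :> R by rewrite ltr0n.
have XD i : \int[P]_(w in D) sqn (X i w) <= v * fine (P D).
  rewrite -lee_fin /Rintegral fineK.
    by rewrite EFinM fineK ?fin_num_measure//; exact: X_le.
  by apply: integrable_fin_num => //; apply: (integrableS measurableT) => //; case: (sqiX i).
have XX i j l : (i < j)%N -> \int[P]_(w in D) (X i w 0 l * X j w 0 l) = 0.
  move=> ij; apply: (@dev_uncorrelated _ _ _ _ P _ _ Pxi F gF gf Lsq gradF mF unb lipgf C
    (xi i) (xi j) y D l) => //; first exact: xilaw.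
  - by move=> *; apply: ind3 => //; rewrite neq_ltn ij.
  - exact: sqiX.
  - exact: sqiX.
have [sS leS] := Rintegral_sqn_sum_le n mD sqiX XD XX.
have iS : P.-integrable D (EFin \o (fun w => sqn (\sum_(i < n) X i w))).
  by apply: (integrableS measurableT) => //; case: sS.
rewrite (eq_integral (fun w => (n%:R^-1 ^+ 2)%:E * (sqn (\sum_(i < n) X i w))%:E)%E).
  rewrite integralZl// [leRHS](eq_integral (cst (v / n%:R)%:E)).
    rewrite integral_cst// -[X in (_ * X <= _)%E]fineK ?integrable_fin_num//.
    rewrite -[X in (_ <= _ * X)%E]fineK ?fin_num_measure// -!EFinM lee_fin.
    apply: (@le_trans _ _ (n%:R^-1 ^+ 2 * (n%:R * (v * fine (P D))))).
      by rewrite ler_wpM2l ?sqr_ge0.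
    rewrite le_eqVlt; apply/orP; left; apply/eqP.
    by move: (fine _) => q; field; rewrite gt_eqF.
  by move=> w; rewrite inE => -[_ /= ->].
by move=> w; rewrite inE => -[_ /= Nw]; rewrite (errE Nw) sqnZ EFinM.
Qed.

Lemma sample_mean_sqi : sqi P (fun w => g w - gf (y w)).
Proof.
split=> //; apply/integrableP; split.
  by apply/measurable_EFinP; exact: mvec_sqn.
under eq_integral => w _ do rewrite /= ger0_norm ?sqn_ge0//.
apply: (le_lt_trans (sample_mean_var (@measurableT _ OC))).
apply: (@le_lt_trans _ _ (\int[P]_w (cst v%:E w))%E).
  apply: ge0_le_integral => //.
  - by move=> w _; rewrite lee_fin divr_ge0.
  - apply/measurable_EFinP.
    exact: (@measurable_nat_partition _ _ _ N (fun n => v / n%:R)).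
  - by move=> w _; rewrite lee_fin ler_pdivrMr ?ltr0n// ler_peMr// ler1n.
rewrite integral_cst// [X in (_ * X)%E](_ : _ = 1%E) ?mule1 ?ltry//.
exact: probability_setT.
Qed.

(** On [{N = n}] the product expands into finitely many terms, one for each sample and coordinate.
    In each of them the weight, the indicator times a coordinate of [u], is past-measurable and
    multiplies one centred deviation. *)
Lemma sample_mean_unbiased (u : O -> 'rV[R]_d) : mvec (u : OC -> _) -> sqi P u ->
  \int[P]_w dotv (g w - gf (y w)) (u w) = 0.
Proof.
move=> mu su; have se := sample_mean_sqi.
apply: (@integral_partition_eq0 _ _ _ P _ N) => //; first exact: sqi_dotv.
move=> n; set D := _ @^-1` _.
have CD : <<s C >> D by exact: CN.
have mD : measurable D by exact: CM.
pose a l w := \1_D w * u w 0 l.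
have ma l : measurable_fun (setT : set OC) (a l).
  by apply: measurable_funM; [exact: measurable_indic|exact: mu].
have iaX l j : P.-integrable setT (EFin \o (fun w => a l w * X j w 0 l)).
  apply: (@integrable_dominated _ _ _ _ _ _ (fun w => `|u w 0 l * X j w 0 l|)) => //.
  - apply: measurable_funM; last exact: mX.
    exact: (measurable_fun_sub CM (ma l)).
  - move=> w _; rewrite /a -mulrA normrM; rewrite indicE.
    by case: (_ \in _); rewrite ?normr1 ?normr0 ?mul1r ?mul0r.
  by apply: (@integrable_norm _ _ _ P setT (fun w => u w 0 l * X j w 0 l)); exact: sqi_coordM.
rewrite Rintegral_mkcond.
rewrite (_ : _ \_ _ = fun w => \sum_(p : 'I_n * 'I_d) n%:R^-1 * (a p.2 w * X p.1 w 0 p.2)).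
  apply: Rintegral_sum_eq0 => //.
    by move=> p; exact: (integrableZl measurableT n%:R^-1 (iaX p.2 p.1)).
  move=> p; rewrite RintegralZl//.
  by rewrite (@dev_mean0 _ _ _ _ P _ _ Pxi F gF gf Lsq gradF mF unb lipgf C (xi p.1) y CM
    (mxi p.1) (@xilaw p.1) (@ind2 p.1) my _ _ (ma p.2) (iaX p.2 p.1)) mulr0.
apply/funext => w; rewrite /patch /a indicE.
case: ifPn => wD; last first.
  by rewrite big1// => p _; rewrite !mul0r mulr0.
rewrite inE in wD; rewrite (errE wD) dotvZl.
rewrite -(pair_bigA _ (fun (i : 'I_n) (l : 'I_d) => n%:R^-1 * (1 * u w 0 l * X i w 0 l)))/= exchange_big/=.
rewrite mulr_sumr; apply: eq_bigr => l _.
rewrite summxE mulr_suml mulr_sumr; apply: eq_bigr => i _.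
by rewrite mul1r [u w 0 l * _]mulrC.
Qed.

End SampleMean.

(** * Counting samples and iterations *)

Section SampleSize.
Variables (R : realType) (sigma eta iota0sq deltasq : R).

Local Notation den cn2 := (eta ^+ 2 / 4 * cn2 + iota0sq * deltasq).
Local Notation size := (sample_size sigma eta iota0sq deltasq).

Lemma sample_size_gt0 cn2 : (0 < size cn2)%N.
Proof. by rewrite /sample_size leq_max leqnn. Qed.

Let quot_ge0 cn2 : 0 < den cn2 -> 0 <= sigma ^+ 2 / den cn2.
Proof. by move=> D0; rewrite divr_ge0 ?sqr_ge0// ltW. Qed.

Let abs_ceil q : 0 <= q -> `|Num.ceil (q : R)|%N%:Z = Num.ceil q.
Proof. by move=> q0; rewrite gez0_abs// -(@ceil0 R); exact: le_ceil. Qed.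

(** Comparing the ceiling with an integer becomes an inequality linear in [cn2]; both the variance
    bound and the measurability of the sample number are read off from it. *)
Lemma sample_size_le cn2 m : 0 < den cn2 -> (0 < m)%N ->
  (size cn2 <= m)%N = (sigma ^+ 2 <= m%:R * den cn2).
Proof.
move=> D0 m0; rewrite /sample_size geq_max m0 /= -ler_pdivrMr//.
have q0 := quot_ge0 D0.
by rewrite -lez_nat abs_ceil// ceil_le_int.
Qed.

Lemma sample_size_var cn2 : 0 < den cn2 -> sigma ^+ 2 / (size cn2)%:R <= den cn2.
Proof.
move=> D0; rewrite ler_pdivrMr ?ltr0n ?sample_size_gt0// mulrC.
by rewrite -sample_size_le// sample_size_gt0.
Qed.

(** One unit comes from the maximum with 1, the other from rounding up. *)
Lemma sample_size_ub cn2 : 0 < den cn2 -> (size cn2)%:R <= 2 + sigma ^+ 2 / den cn2.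
Proof.
move=> D0; have q0 := quot_ge0 D0.
rewrite /sample_size; set q := _ / _ in q0 *.
apply: (@le_trans _ _ (1 + `|Num.ceil q|%N)%N%:R); first by rewrite ler_nat geq_max leq_addr leq_addl.
rewrite natrD (_ : `|Num.ceil q|%N%:R = (Num.ceil q)%:~R); last by rewrite pmulrn abs_ceil.
by have := ceilB1_lt q; rewrite intrB; lra.
Qed.

Lemma sample_size_measurable (dT : measure_display) (T : measurableType dT)
    (c2 : T -> R) n : measurable_fun setT c2 -> (forall w, 0 < den (c2 w)) ->
  measurable ((fun w => size (c2 w)) @^-1` [set n]).
Proof.
move=> mc D0.
have mle m : measurable [set w | (size (c2 w) <= m)%N].
  case: m => [|m].
    rewrite (_ : mkset _ = set0)//; apply/seteqP; split => // w /=.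
    by rewrite leqNgt sample_size_gt0.
  rewrite (_ : mkset _ = (fun w => m.+1%:R * den (c2 w)) @^-1` `[sigma ^+ 2, +oo[).
    rewrite -[X in measurable X]setTI; apply: (_ : measurable_fun _ _) => //.
    apply: measurable_funM => //; apply: measurable_funD => //.
    exact: measurable_funM.
  by apply/seteqP; split => w /=; rewrite sample_size_le// in_itv/= andbT.
case: n => [|n].
  rewrite (_ : _ @^-1` _ = [set w | (size (c2 w) <= 0)%N])//.
  by apply/seteqP; split => w /= => [->//|]; rewrite leqn0 => /eqP.
rewrite (_ : _ @^-1` _ = [set w | (size (c2 w) <= n.+1)%N] `\` [set w | (size (c2 w) <= n)%N]).
  exact: measurableD.
apply/seteqP; split => w /= => [->|[h1 /negP]]; first by rewrite ltnn.
by rewrite -ltnNge => h2; apply/eqP; rewrite eqn_leq h1.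
Qed.

End SampleSize.

Lemma powR_subr1 (R : realType) (x a : R) : 0 < x -> x `^ (- (1 + a)) = x `^ (- a) / x.
Proof.
move=> x0; have -> : - (1 + a) = - a + - 1 by ring.
rewrite powRD; last by rewrite (gt_eqF x0) implybT.
by congr (_ * _); rewrite powRN powRr1// ltW.
Qed.

(** A discrete integral test: [nu y^(-(1 + nu)) <= (y - 1)^(-nu) - y^(-nu)] telescopes. The
    induction carries the remainder [n.+1 ^ (-nu)] and starts from the single term 1, where it is an
    equality. *)
Lemma sum_inv_powR_le (R : realType) (nu : R) (n : nat) : 0 < nu ->
  \sum_(k < n) (k.+1%:R : R) `^ (- (1 + nu)) <= 1 + nu^-1.
Proof.
move=> nu0.
suff : \sum_(k < n.+1) (k.+1%:R : R) `^ (- (1 + nu)) <= 1 + nu^-1 * (1 - n.+1%:R `^ (- nu)).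
  rewrite big_ord_recr/= => H.
  apply: (le_trans (le_trans _ H)); first by rewrite lerDl powR_ge0.
  by rewrite lerD2l ler_piMr ?invr_ge0 ?(ltW nu0)// gerBl powR_ge0.
elim: n => [|n IH].
  by rewrite big_ord_recr big_ord0/= !powR1 subrr mulr0 add0r addr0.
rewrite big_ord_recr/=; apply: le_trans (lerD IH (lexx _)) _.
have n0 : 0 < n.+1%:R :> R by rewrite ltr0n.
have m0 : 0 < n.+2%:R :> R by rewrite ltr0n.
set x := n.+1%:R; set y := n.+2%:R.
have xy : x = y - 1 by rewrite /x /y -[n.+2%:R]natr1 addrK.
(* [ln] lies below its tangent at [1], [expR] above its own at [0] *)
suff H : y `^ (- (1 + nu)) * nu <= x `^ (- nu) - y `^ (- nu).
  have : nu^-1 * (y `^ (- (1 + nu)) * nu) <= nu^-1 * (x `^ (- nu) - y `^ (- nu)).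
    by rewrite ler_pM2l// invr_gt0.
  rewrite mulrCA mulVf ?gt_eqF// mulr1.
  by lra.
have -> : y `^ (- (1 + nu)) = y `^ (- nu) / y.
  exact: powR_subr1.
have -> : x `^ (- nu) = y `^ (- nu) * (x / y) `^ (- nu).
  rewrite -powRM ?divr_ge0 ?ltW// mulrC divfK// gt_eqF//.
rewrite -mulrA -[X in _ - X]mulr1 -mulrBr ler_pM2l ?powR_gt0//.
have xy0 : 0 < x / y by rewrite divr_gt0.
rewrite lerBrDl /powR gt_eqF//.
apply: le_trans (expR_ge1Dx _).
rewrite lerD2l mulNr -mulrN mulrC ler_pM2l//.
have xyE : x / y = 1 + - y^-1 by rewrite xy mulrBl divff ?gt_eqF// mul1r.
have : ln (x / y) <= - y^-1.
  rewrite xyE; apply: le_ln1Dx; rewrite ltrNl opprK invf_lt1//.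
  by rewrite /y ltr1n.
by rewrite lerNr.
Qed.

Section Counting.
Variables (R : realType) (dO : measure_display) (O : measurableType dO)
  (P : probability O R).
Variables (Eterm : nat -> \bar R) (rterm : nat -> O -> R) (N : nat -> O -> nat).

(** This bounds [K_eps] through the deterministic term alone: before [K_eps] both terms of the
    minimum exceed [eps], in particular [Eterm]. *)
Definition iterations_le (a C : R) := forall (eps : R) (n : nat), 0 < eps <= 1 ->
  (forall k, (k < n)%N -> (eps%:E < Eterm k)%E) -> n%:R <= C * eps `^ (- a).

(** If the tolerance were never reached, [Eterm] would stay above [eps] for more than [C eps^(-a)]
    indices; hence [K_eps] exists. It remains to bound the cost of any [n] iterations along which
    the residual exceeds [eps]. *)
Lemma evals_bigO_from (a C Cs rate : R) : 0 < C -> iterations_le a C -> 0 < Cs ->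
  {ae P, forall w, forall (eps : R) (n : nat), 0 < eps <= 1 ->
    (forall k, (k < n)%N -> eps < rterm k w) -> n%:R <= C * eps `^ (- a) ->
    (\sum_(k < n) N k w)%:R <= Cs * eps `^ (- rate)} ->
  evals_bigO P Eterm rterm N rate.
Proof.
move=> C0 iC Cs0 aeN; exists Cs, 1; split => //; split => // eps eps1.
apply: filterS aeN => w Nw.
pose reached k := (mine (Eterm k) (rterm k w)%:E <= eps%:E)%E.
have nreached k : ~~ reached k -> (eps%:E < Eterm k)%E /\ eps < rterm k w.
  by rewrite /reached -ltNge lt_min lte_fin => /andP[].
have exK : exists k, reached k.
  apply: contrapT => nex.
  have H k : ~~ reached k by apply/negP => rk; apply: nex; exists k.
  pose n := (Num.truncn (C * eps `^ (- a))).+1.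
  have := iC eps n eps1 (fun k _ => (nreached k (H k)).1).
  by rewrite leNgt truncnS_gt.
case: (ex_minnP exK) => K rK minK; exists K; split => //.
have ltK k : (k < K)%N -> ~~ reached k.
  by move=> kK; apply/negP => /minK; rewrite leqNgt kK.
split; first by move=> k /ltK /negP.
apply: Nw => //; first by move=> k /ltK /nreached[].
by apply: iC => // k /ltK /nreached[].
Qed.

Let leeps (eps r s : R) : 0 < eps <= 1 -> r <= s -> eps `^ (- r) <= eps `^ (- s).
Proof.
by move=> eps1 rs; rewrite ger_powR// lerN2.
Qed.

(** Each of the first [n] iterations costs at most [Cn n^b], in total [Cn n^(1 + b)] with
    [n <= C eps^(-a)]. *)
Lemma evals_bigO_poly (a b C Cn rate : R) : 0 <= a -> 0 <= b -> 0 < C -> 0 < Cn ->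
  a * (1 + b) <= rate -> iterations_le a C ->
  (forall k w, (N k w)%:R <= Cn * k.+1%:R `^ b) ->
  evals_bigO P Eterm rterm N rate.
Proof.
move=> a0 b0 C0 Cn0 ab iC NC.
apply: (@evals_bigO_from a C (Cn * C `^ (1 + b))) => //.
  by rewrite mulr_gt0// powR_gt0.
apply: aeW => w eps n eps1 _ nC; have /andP[eps0 _] := eps1.
apply: (@le_trans _ _ (Cn * n%:R `^ (1 + b))).
  have -> : Cn * n%:R `^ (1 + b) = \sum_(k < n) Cn * n%:R `^ b.
    rewrite sumr_const card_ord -[RHS]mulr_natl powRD; last by rewrite gt_eqF// ltr_pwDl.
    by rewrite powRr1//; ring.
  rewrite natr_sum; apply: ler_sum => k _; apply: (le_trans (NC _ _)).
  by rewrite ler_pM2l// ge0_ler_powR// ?nnegrE// ler_nat.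
rewrite -mulrA ler_pM2l//.
apply: (@le_trans _ _ ((C * eps `^ (- a)) `^ (1 + b))).
  by rewrite ge0_ler_powR// ?nnegrE ?addr_ge0// mulr_ge0 ?powR_ge0// ltW.
rewrite powRM ?powR_ge0 ?(ltW C0)// ler_pM2l ?powR_gt0// -powRrM mulNr.
exact: leeps.
Qed.

(** Before [K_eps] the residual exceeds [eps], so each iteration costs at most [(2 + Cn) / eps]; the
    2 is absorbed because [eps <= 1]. *)
Lemma evals_bigO_residual (a C Cn rate : R) : 0 <= a -> 0 < C -> 0 <= Cn ->
  a + 1 <= rate -> iterations_le a C ->
  {ae P, forall w k, 0 < rterm k w -> (N k w)%:R <= 2 + Cn / rterm k w} ->
  evals_bigO P Eterm rterm N rate.
Proof.
move=> a0 C0 Cn0 arate iC NC.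
apply: (@evals_bigO_from a C (C * (2 + Cn))) => //.
  by rewrite mulr_gt0// ltr_pwDl.
apply: filterS NC => w NC eps n eps1 rn nC; have /andP[eps0 eps_le1] := eps1.
apply: (@le_trans _ _ (\sum_(k < n) ((2 + Cn) / eps))).
  rewrite natr_sum; apply: ler_sum => k _.
  have rk := rn k (ltn_ord k).
  apply: (le_trans (NC k (lt_trans eps0 rk))).
  rewrite mulrDl lerD//.
    by rewrite ler_pdivlMr// ler_piMr.
  by rewrite ler_wpM2l// lef_pV2 ?posrE ?(lt_trans eps0 rk)// ltW.
rewrite sumr_const card_ord -[leLHS]mulr_natl.
apply: (@le_trans _ _ (C * eps `^ (- a) * ((2 + Cn) / eps))).
  by rewrite ler_wpM2r// divr_ge0 ?addr_ge0// ltW.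
have -> : C * eps `^ (- a) * ((2 + Cn) / eps) = C * (2 + Cn) * (eps `^ (- a) * eps^-1).
  by ring.
have -> : eps `^ (- a) * eps^-1 = eps `^ (- (a + 1)).
  by rewrite addrC powR_subr1.
by rewrite ler_pM2l ?leeps// mulr_gt0// ltr_pwDl.
Qed.

End Counting.

(** * Conditional expectations of random vectors *)

Section CondexpVector.
Variables (R : realType) (d : nat) (dO : measure_display) (O : measurableType dO)
  (P : probability O R) (C : set (set O)).
Let OC : measurableType _ := g_sigma_algebraType C.
Hypothesis CM : <<s C >> `<=` measurable.

Lemma condexp_vec_mvec (X Z : O -> 'rV[R]_d) : is_condexp_vec P <<s C >> X Z ->
  mvec (Z : OC -> _).
Proof. by move=> cXZ j _ B mB; rewrite setTI; case: (cXZ j) => _ ZC *; exact: ZC. Qed.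

Lemma condexp_vec_sqn_le (X Z : O -> 'rV[R]_d) (A : set O) :
  is_condexp_vec P <<s C >> X Z -> sqi P X -> <<s C >> A ->
  (\int[P]_(w in A) (sqn (Z w))%:E <= \int[P]_(w in A) (sqn (X w))%:E)%E.
Proof.
move=> cXZ sX CA; have mA := CM CA.
have mZ := mvec_sub CM (condexp_vec_mvec cXZ).
have split_sum (Y : O -> 'rV[R]_d) : mvec Y -> (\int[P]_(w in A) (sqn (Y w))%:E =
    \sum_(j < d) \int[P]_(w in A) (Y w 0 j ^+ 2)%:E)%E.
  move=> mY; rewrite -ge0_integral_sum//.
  - by apply: eq_integral => w _; rewrite sumEFin.
  - move=> j; apply/measurable_EFinP; apply: measurable_funTS.
    exact: measurable_funX.
  - by move=> j w _; rewrite lee_fin sqr_ge0.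
rewrite !split_sum//; last by case: sX.
apply: lee_sum => j _; apply: (condexp_sqr_le (cXZ j)) => //.
exact: sqi_coordM.
Qed.

Lemma condexp_vec_sqi (X Z : O -> 'rV[R]_d) :
  is_condexp_vec P <<s C >> X Z -> sqi P X -> sqi P Z.
Proof.
move=> cXZ sX; have mZ := mvec_sub CM (condexp_vec_mvec cXZ).
split=> //; apply/integrableP; split; first by apply/measurable_EFinP; exact: mvec_sqn.
under eq_integral => w _ do rewrite /= ger0_norm ?sqn_ge0//.
apply: (le_lt_trans (condexp_vec_sqn_le cXZ sX (@measurableT _ OC))).
by case: sX => _ iX; rewrite ltey_eq integrable_fin_num.
Qed.

(** A vector known from the past passes through the conditional expectation. With [r] the exact
    residual this turns Jensen's inequality into a bound on [c - r]. *)
Lemma condexp_vecB (X Z r : O -> 'rV[R]_d) : is_condexp_vec P <<s C >> X Z ->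
  mvec (r : OC -> _) -> sqi P r ->
  is_condexp_vec P <<s C >> (fun w => X w - r w) (fun w => Z w - r w).
Proof.
move=> cXZ mr sr j; have [_ ZC iX iZ ZX] := cXZ j.
have ir := sqi_coord j sr.
have mZ := condexp_vec_mvec cXZ.
have irB (Y : O -> 'rV[R]_d) : P.-integrable setT (EFin \o (fun w => Y w 0 j)) ->
    P.-integrable setT (fun w => ((Y w - r w) 0 j)%:E).
  move=> iY; rewrite (_ : (fun w => _) = (fun w => (Y w 0 j)%:E - (r w 0 j)%:E)%E).
    exact: (integrableB measurableT iY ir).
  by apply/funext => w /=; rewrite !mxE.
split => //; try exact: irB.
- move=> B mB; have := @mvecB _ _ _ OC _ _ mZ mr j measurableT B mB.
  by rewrite setTI.
- move=> A CA; have mA := CM CA.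
  have iA (f : O -> R) : P.-integrable setT (EFin \o f) -> P.-integrable A (EFin \o f).
    by apply: integrableS.
  have E (Y : O -> 'rV[R]_d) : P.-integrable setT (EFin \o (fun w => Y w 0 j)) ->
      (\int[P]_(w in A) ((Y w - r w) 0 j)%:E =
       \int[P]_(w in A) (Y w 0 j)%:E - \int[P]_(w in A) (r w 0 j)%:E)%E.
    move=> iY; rewrite -integralB//; [|exact: iA|exact: iA].
    by apply: eq_integral => w _; rewrite !mxE.
  by rewrite !E// ZX.
Qed.

End CondexpVector.

(** On the event where the inequality fails, [f - g] is positive while its integral is at most zero,
    so the event is null. *)
Lemma negligible_of_integral_le (R : realType) (dO : measure_display)
    (O : measurableType dO) (P : probability O R) (f g : O -> R) :
  P.-integrable setT (EFin \o f) -> P.-integrable setT (EFin \o g) ->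
  (\int[P]_(w in [set w | (g w < f w)%R]) (f w)%:E <=
   \int[P]_(w in [set w | (g w < f w)%R]) (g w)%:E)%E ->
  {ae P, forall w, f w <= g w}.
Proof.
move=> fi gi; set A := [set w | g w < f w] => fgA.
have mf : measurable_fun setT f by apply/measurable_EFinP; case/integrableP: fi.
have mg : measurable_fun setT g by apply/measurable_EFinP; case/integrableP: gi.
have mA : measurable A.
  have := @measurable_fun_ltr _ _ R setT g f mg mf measurableT [set true] I.
  by rewrite setTI; congr measurable; apply/seteqP; split.
have fA := integrableS measurableT mA (@subsetT _ A) fi.
have gA := integrableS measurableT mA (@subsetT _ A) gi.
have : ae_eq P A (fun w => (f w - g w)%:E) (cst 0%E).
  apply/(ae_eq_integral_abs P mA).
    by apply/measurable_EFinP; apply: measurable_funTS; exact: measurable_funB.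
  apply/eqP; rewrite eq_le integral_ge0//.
  rewrite andbT (eq_integral (fun w => (f w)%:E - (g w)%:E)%E).
    by rewrite integralB// sube_le0.
  by move=> w; rewrite inE => Aw; rewrite gee0_abs// lee_fin subr_ge0 ltW.
apply: filterS => w Hw; rewrite leNgt; apply/negP => Aw.
by have /(_ Aw) /= [/eqP] := Hw; rewrite subr_eq0 gt_eqF.
Qed.

(** * From gap estimates to iteration counts *)

Section IterationBounds.
Variables (R : realType) (Eterm : nat -> \bar R) (E : nat -> R) (M : R).
Hypothesis EtermE : forall k, Eterm k.+1 = (E k.+1)%:E.
Hypothesis M0 : 0 <= M.

(** Among [n + 1] indices with gap above [eps], the last [n] give [n * eps <= M]. Index 0, where the
    gap may be infinite, contributes the extra 1 through [eps <= 1]. *)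
Lemma iterations_le_sum : (forall n, \sum_(k < n) E k.+1 <= M) ->
  iterations_le Eterm 1 (1 + M).
Proof.
move=> sM eps [|n] /andP[eps0 eps1] H; first by rewrite mulr_ge0 ?powR_ge0// addr_ge0.
have : n%:R * eps <= M.
  apply: le_trans (sM n); rewrite mulr_natl -[n in _ *+ n]card_ord -sumr_const.
  apply: ler_sum => k _; have := H k.+1; rewrite ltnS ltn_ord => /(_ isT).
  by rewrite EtermE lte_fin => /ltW.
rewrite powRN powRr1 ?(ltW eps0)// ler_pdivlMr// -natr1 => H'; lra.
Qed.

Lemma iterations_le_sqr : (forall k, k.+2%:R ^+ 2 * E k.+1 <= 4 * M) ->
  iterations_le Eterm (1 / 2) (1 + 4 * M).
Proof.
move=> sM eps n /andP[eps0 eps1] H.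
have M1 : 1 <= 1 + 4 * M by rewrite lerDl mulr_ge0.
have M2 : 0 <= 1 + 4 * M by exact: le_trans M1.
set s := eps `^ (- (1 / 2)).
have s1 : 1 <= s.
  rewrite /s -[leLHS](powRr0 eps) ger_powR ?eps0 ?eps1//; lra.
have s0 : 0 < s by lra.
have s2 : s ^+ 2 * eps = 1.
  rewrite /s -powR_mulrn ?powR_ge0// -powRrM -[X in _ * X](powRr1 (ltW eps0)).
  rewrite -powRD; last by rewrite (gt_eqF eps0) implybT.
  by rewrite (_ : _ + _ = 0) ?powRr0//; lra.
case: n H => [|[|n]] H.
- by rewrite mulr_ge0 ?(ltW s0).
- by rewrite -[leLHS]mul1r; exact: ler_pM.
rewrite -(@ler_pXn2r _ 2)// ?nnegrE ?mulr_ge0 ?(ltW s0)//.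
rewrite exprMn.
have := H n.+1 (leqnn _); rewrite EtermE lte_fin => He.
have Hn := sM n.
have : n.+2%:R ^+ 2 * eps <= 4 * M.
  by apply: le_trans Hn; rewrite ler_wpM2l ?sqr_ge0// ltW.
move=> H1; have : s ^+ 2 * (n.+2%:R ^+ 2 * eps) <= s ^+ 2 * (4 * M).
  by rewrite ler_wpM2l ?sqr_ge0.
(* It remains to use [4 * M <= (1 + 4 * M) ^+ 2], which avoids a square root in the constant. *)
rewrite mulrCA s2 mulr1 => /le_trans; apply.
rewrite mulrC ler_wpM2r ?sqr_ge0//.
rewrite sqrrD expr1n; have := sqr_ge0 (4 * M).
by move: M0; rewrite /GRing.exp/=; lra.
Qed.

End IterationBounds.

Lemma telescoping_sum_le (R : realType) (E D e : nat -> R) (b S : R) : 0 <= b ->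
  (forall k, 0 <= D k) -> (forall n, \sum_(k < n) e k <= S) ->
  (forall k, E k.+1 <= b * (D k - D k.+1) + e k) ->
  forall n, \sum_(k < n) E k.+1 <= b * D 0%N + S.
Proof.
move=> b0 D0 eS rec n.
suff : \sum_(k < n) E k.+1 <= b * (D 0%N - D n) + \sum_(k < n) e k.
  move=> /le_trans; apply; apply: lerD => //.
  by rewrite ler_wpM2l// gerBl.
elim: n => [|n IH]; first by rewrite !big_ord0 subrr mulr0 addr0.
rewrite !big_ord_recr/=; have := lerD IH (rec n) => /le_trans; apply.
by rewrite le_eqVlt; apply/orP; left; apply/eqP; ring.
Qed.

(* With [theta_k = 2 / (k + 1)], dividing by [theta_(k+1) ^+ 2] makes the
   recursion telescope, because [(1 - theta_(k+1)) / theta_(k+1) ^+ 2 <= 1 / theta_k ^+ 2]. *)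
Lemma accelerated_recursion_le (R : realType) (E V e : nat -> R) (b S : R) :
  0 <= b -> (forall k, 0 <= E k.+1) -> (forall k, 0 <= V k) -> (forall k, 0 <= e k) ->
  (forall n, \sum_(k < n) k.+1%:R ^+ 2 * e k <= S) ->
  (forall k, let theta := 2 / k.+2%:R in
     E k.+1 <= (1 - theta) * E k + b * theta ^+ 2 * (V k - V k.+1) + e k) ->
  forall k, k.+2%:R ^+ 2 * E k.+1 <= 4 * (b * V 0%N + S).
Proof.
move=> b0 E0 V0 e0 eS rec k.
have step j : j.+2%:R ^+ 2 * E j.+1 + 4 * b * V j.+1 <=
    j%:R * j.+2%:R * E j + 4 * b * V j + 4 * (j.+1%:R ^+ 2 * e j).
  have j0 : 0 < j.+2%:R :> R by rewrite ltr0n.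
  have := ler_wpM2l (sqr_ge0 (j.+2%:R : R)) (rec j) => /=.
  have -> : j.+2%:R ^+ 2 * ((1 - 2 / j.+2%:R) * E j + b * (2 / j.+2%:R) ^+ 2 * (V j - V j.+1) + e j) =
    (j.+2%:R - 2) * j.+2%:R * E j + 4 * b * (V j - V j.+1) + j.+2%:R ^+ 2 * e j.
    by move: (E j) (V j) (V j.+1) (e j) => *; field; rewrite gt_eqF.
  have -> : j.+2%:R - 2 = j%:R :> R by rewrite -addn2 natrD addrK.
  (* The recursion produces the weight [(j + 2)^2], the summability hypothesis has [(j + 1)^2]; they
     differ by a factor of at most 4. *)
  have : j.+2%:R ^+ 2 * e j <= 4 * (j.+1%:R ^+ 2 * e j).
    rewrite mulrA ler_wpM2r// -[4](_ : 2 ^+ 2 = 4); last by ring.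
    rewrite -exprMn ler_pXn2r ?nnegrE// -natrM ler_nat mul2n -addnn.
    by rewrite addSn ltnS leq_addl.
  lra.
suff : k.+2%:R ^+ 2 * E k.+1 + 4 * b * V k.+1 <=
    4 * b * V 0%N + 4 * \sum_(j < k.+1) j.+1%:R ^+ 2 * e j.
  have := eS k.+1; have : 0 <= 4 * b * V k.+1 by rewrite !mulr_ge0.
  lra.
elim: k => [|k IH].
  (* The coefficient [j (j + 2)] of [E j] vanishes at [j = 0], so [E 0], on which nothing is
     assumed, drops out. *)
  apply: (le_trans (step 0%N)); rewrite big_ord_recr big_ord0/= !mul0r !add0r.
  by [].
apply: (le_trans (step k.+1)); rewrite big_ord_recr/=.
set S' := \sum_(j < k.+1) _ in IH *; rewrite [4 * (S' + _)]mulrDr [leRHS]addrA lerD2r.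
apply: le_trans IH; rewrite lerD2r ler_wpM2r// -!natr1.
by have : 0 <= k%:R :> R by []; move: (k%:R : R) => q; nra.
Qed.

(** * The sampled proximal gradient iteration *)

Section Run.
Variables (R : realType) (d : nat) (dO : measure_display) (O : measurableType dO)
  (P : probability O R) (dX : measure_display) (Xi : measurableType dX)
  (Pxi : probability Xi R).
Variables (F : 'rV[R]_d -> Xi -> R) (gF : 'rV[R]_d -> Xi -> 'rV[R]_d)
  (f : 'rV[R]_d -> R) (gf : 'rV[R]_d -> 'rV[R]_d)
  (h : 'rV[R]_d -> \bar R) (prox : R -> 'rV[R]_d -> 'rV[R]_d)
  (L sigma eta iota0sq alpha : R) (xstar : 'rV[R]_d).
Hypothesis HF : forall z, is_gradient (F ^~ z) (gF ^~ z).
Hypothesis mF : forall x, measurable_fun setT (F x).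
Hypothesis Hunb : forall x (j : 'I_d), Pxi.-integrable setT (fun z => (gF x z 0 j)%:E) /\
  (\int[Pxi]_(z in setT) (gF x z 0 j)%:E)%E = (gf x 0 j)%:E.
Hypotheses (Hfcvx : convex_fun f) (Hgf : is_gradient f gf) (HL : 0 < L).
Hypothesis Hlip : forall u v, sqn (gf u - gf v) <= L ^+ 2 * sqn (u - v).
Hypotheses (Hhcvx : convex_efun h) (Hhprop : proper_efun h) (Hhcl : closed_efun h).
Hypothesis Hprox : forall a v, 0 < a -> is_prox h a v (prox a v).
Hypothesis Hmin : forall z, (phi_of f h xstar <= phi_of f h z)%E.
Hypothesis Heta : 0 < eta < 1.
Hypothesis Hiota : 0 <= iota0sq.
Hypothesis alpha0 : 0 < alpha.
Hypothesis HLalpha : L * alpha <= 1 - eta - iota0sq.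

Variables (optII : bool) (deltasq : nat -> R) (x y g c : nat -> O -> 'rV[R]_d)
  (N : nat -> O -> nat) (xi : nat -> nat -> O -> Xi).
Hypothesis Hrun :
  sampled_run P Pxi gF prox optII alpha sigma eta iota0sq deltasq x y g c N xi.
Hypothesis HV : assumptionV P Pxi gF gf sigma y.
Hypothesis delta0 : forall k, 0 <= deltasq k.

Let C k : set (set O) :=
  preim_sys_vec (x 0%N) `|` \bigcup_(i in [set i | (i < k)%N]) preim_sys_vec (g i).
Let OC k : measurableType _ := g_sigma_algebraType (C k).
Let Rk k w := alpha^-1 *: (y k w - x k.+1 w).

Let x0_cst : exists x0, forall w, x 0%N w = x0. Proof. by case: Hrun. Qed.
Let y0E : y 0%N = x 0%N. Proof. by case: Hrun => _ []. Qed.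
Let xiP k j : measurable_fun setT (xi k j) /\
  forall A, measurable A -> P (xi k j @^-1` A) = Pxi A.
Proof. by case: Hrun => _ [_ [H _]]; exact: H. Qed.
Let xi_indep k : mutual_indep P (fun i : option nat =>
  match i with None => <<s C k >> | Some j => [set xi k j @^-1` B | B in measurable] end).
Proof. by case: Hrun => _ [_ [_ [H _]]]; exact: H. Qed.
Let cP k : is_condexp_vec P <<s C k >> (Rk k) (c k).
Proof. by case: Hrun => _ [_ [_ [_ [H _]]]]; exact: H. Qed.
Let NP k w : 0 < eta ^+ 2 / 4 * sqn (c k w) + iota0sq * deltasq k /\
  N k w = sample_size sigma eta iota0sq (deltasq k) (sqn (c k w)).
Proof. by case: Hrun => _ [_ [_ [_ [_ [H _]]]]]; exact: H. Qed.
Let gE k w : g k w = (N k w)%:R^-1 *: \sum_(j < N k w) gF (y k w) (xi k j w).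
Proof. by case: Hrun => _ [_ [_ [_ [_ [_ [H _]]]]]]; exact: H. Qed.
Let xE k w : x k.+1 w = prox alpha (y k w - alpha *: g k w).
Proof. by case: Hrun => _ [_ [_ [_ [_ [_ [_ [H _]]]]]]]; exact: H. Qed.
Let yE k w : y k.+1 w =
  if optII then x k.+1 w + beta_acc R k.+1 *: (x k.+1 w - x k w) else x k.+1 w.
Proof. by case: Hrun => _ [_ [_ [_ [_ [_ [_ [_ H]]]]]]]; exact: H. Qed.

Let CM k : <<s C k >> `<=` measurable.
Proof.
apply: smallest_sub; first exact: sigma_algebra_measurable.
move=> S CkS; have sCS : <<s C k >> S by exact: sub_sigma_algebra.
(* The inclusion of the filtration in the measurable sets is part of [is_condexp], which is stated
   per coordinate. A generator always comes with a coordinate; in dimension 0 there is none to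
   check. *)
have [j _] : exists j : 'I_d, True.
  by case: CkS => [[j _ _]|[i _ [j _ _]]]; exists j.
by case: (cP k j) => CkM _ _ _ _; exact: CkM.
Qed.

Let CS k : <<s C k >> `<=` <<s C k.+1 >>.
Proof.
apply: smallest_sub; first exact: smallest_sigma_algebra.
move=> S [S0|[i /= ik Si]]; apply: sub_sigma_algebra; [by left|right].
by exists i => //=; exact: ltnW.
Qed.

Let mvecS k (X : O -> 'rV[R]_d) : mvec (X : OC k -> _) -> mvec (X : OC k.+1 -> _).
Proof. by move=> mX j _ B mB; apply: CS; exact: mX. Qed.

Let mgS k : mvec (g k : OC k.+1 -> _).
Proof.
move=> j _ B mB; rewrite setTI; apply: sub_sigma_algebra; right.
by exists k => //=; exists j => //; exists B.
Qed.

Let prox_lip u v : sqn (prox alpha u - prox alpha v) <= 1 * sqn (u - v).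
Proof.
by rewrite mul1r; apply: (is_prox_nonexpansive Hhcvx Hhprop alpha0); exact: Hprox.
Qed.

Let mxy k : mvec (x k : OC k -> _) /\ mvec (y k : OC k -> _).
Proof.
elim: k => [|k [mx my]].
  have [x0 x0E] := x0_cst.
  have -> : x 0%N = fun=> x0 by apply/funext.
  rewrite y0E (_ : x 0%N = fun=> x0); last exact/funext.
  by split; exact: mvec_cst.
have mx' : mvec (x k.+1 : OC k.+1 -> _).
  rewrite (_ : x k.+1 = fun w => prox alpha (y k w - alpha *: g k w)); last exact/funext.
  apply: (@mvec_lipschitz _ _ _ (OC k.+1) (fun w => y k w - alpha *: g k w) _ _ _ prox_lip).
  apply: (@mvecB _ _ _ (OC k.+1) (y k) (fun w => alpha *: g k w)); first exact: (mvecS my).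
  exact: (@mvecZ _ _ _ (OC k.+1) alpha _ (@mgS k)).
split=> //; rewrite (_ : y k.+1 = fun w =>
    if optII then x k.+1 w + beta_acc R k.+1 *: (x k.+1 w - x k w) else x k.+1 w); last first.
  by apply/funext => w; exact: yE.
case: optII => //.
apply: (@mvecD _ _ _ (OC k.+1)) => //; apply: (@mvecZ _ _ _ (OC k.+1)).
by apply: (@mvecB _ _ _ (OC k.+1)) => //; exact: (mvecS mx).
Qed.

Let mg k : mvec (g k). Proof. exact: (mvec_sub (@CM k.+1) (@mgS k)). Qed.

Let N0 k w : (0 < N k w)%N.
Proof. by have [_ ->] := NP k w; exact: sample_size_gt0. Qed.

Let CN k n : <<s C k >> (N k @^-1` [set n]).
Proof.
rewrite (_ : N k = fun w => sample_size sigma eta iota0sq (deltasq k) (sqn (c k w))).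
  apply: (@sample_size_measurable _ _ _ _ _ _ (OC k) (fun w => sqn (c k w))).
    by apply: mvec_sqn; exact: (condexp_vec_mvec (cP k)).
  by move=> w; case: (NP k w).
by apply/funext => w; case: (NP k w).
Qed.

Let err k w := g k w - gf (y k w).

Let err_sqi k : sqi P (err k).
Proof.
apply: (sample_mean_sqi HF mF Hunb Hlip (@CM k) (fun j => (xiP k j).1)
  (fun j => (xiP k j).2) (@xi_indep k) (mxy k).2 (mg k) (@CN k) (N0 k) (gE k)
  (sqr_ge0 sigma) (HV k)).
Qed.

(** This is Condition C integrated over events of [G_k]: the variance is at most [sigma ^+ 2 / N],
    and the sample-size rule bounds that quotient pointwise. *)
Let err_var k A : <<s C k >> A -> (\int[P]_(w in A) (sqn (err k w))%:E <=
  \int[P]_(w in A) (eta ^+ 2 / 4 * sqn (c k w) + iota0sq * deltasq k)%:E)%E.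
Proof.
move=> CA; have mA := CM CA.
have mc := mvec_sub (@CM k) (condexp_vec_mvec (cP k)).
apply: (@le_trans _ _ (\int[P]_(w in A) (sigma ^+ 2 / (N k w)%:R)%:E)%E).
  apply: (sample_mean_var HF mF Hunb Hlip (@CM k) (fun j => (xiP k j).1)
    (fun j => (xiP k j).2) (@xi_indep k) (mxy k).2 (mg k) (@CN k) (N0 k) (gE k)
    (sqr_ge0 sigma) (HV k)) => //.
apply: ge0_le_integral => //.
- by move=> w _; rewrite lee_fin divr_ge0 ?sqr_ge0.
- apply/measurable_EFinP; apply: measurable_funTS.
  apply: (@measurable_nat_partition _ _ _ (N k) (fun n => sigma ^+ 2 / n%:R)) => n.
  exact: CM (@CN k n).
- apply/measurable_EFinP; apply: measurable_funTS; apply: measurable_funD => //.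
  by apply: measurable_funM => //; exact: mvec_sqn.
- by move=> w _; rewrite lee_fin; have [D0 ->] := NP k w; exact: sample_size_var.
Qed.

Let err_unbiased k (u : O -> 'rV[R]_d) : mvec (u : OC k -> _) -> sqi P u ->
  \int[P]_w dotv (err k w) (u w) = 0.
Proof.
move=> mu su.
apply: (sample_mean_unbiased HF mF Hunb Hlip (@CM k) (fun j => (xiP k j).1)
  (fun j => (xiP k j).2) (@xi_indep k) (mxy k).2 (mg k) (@CN k) (N0 k) (gE k)
  (sqr_ge0 sigma) (HV k)) => //.
Qed.

Let sxy k : sqi P (x k) /\ sqi P (y k).
Proof.
elim: k => [|k [sx sy]].
  have [x0 x0E] := x0_cst.
  rewrite y0E (_ : x 0%N = fun=> x0); last exact/funext.
  by split; exact: sqi_cst.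
have sg : sqi P (g k).
  rewrite (_ : g k = fun w => err k w + gf (y k w)).
    by apply: sqiD => //; exact: (sqi_lipschitz Hlip).
  by apply/funext => w; rewrite /err subrK.
have sx' : sqi P (x k.+1).
  rewrite (_ : x k.+1 = fun w => prox alpha (y k w - alpha *: g k w)); last exact/funext.
  apply: (@sqi_lipschitz _ _ _ P _ _ _ (fun w => y k w - alpha *: g k w) prox_lip).
  by apply: sqiB => //; exact: sqiZ.
split=> //; rewrite (_ : y k.+1 = fun w =>
    if optII then x k.+1 w + beta_acc R k.+1 *: (x k.+1 w - x k w) else x k.+1 w); last first.
  by apply/funext => w; exact: yE.
case: optII => //.
by apply: sqiD => //; apply: sqiZ; exact: sqiB.
Qed.

Let sRk k : sqi P (Rk k).
Proof. by apply: sqiZ; apply: sqiB; [case: (sxy k)|case: (sxy k.+1)]. Qed.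

Let sc k : sqi P (c k).
Proof. exact: (condexp_vec_sqi (@CM k) (cP k)). Qed.

Let xh k w := prox alpha (y k w - alpha *: gf (y k w)).

Let my_grad k : mvec ((fun w => y k w - alpha *: gf (y k w)) : OC k -> _).
Proof.
apply: (@mvecB _ _ _ (OC k)); first by case: (mxy k).
apply: (@mvecZ _ _ _ (OC k)).
exact: (@mvec_lipschitz _ _ _ (OC k) (y k) _ _ (mxy k).2 Hlip).
Qed.

Let mxh k : mvec (xh k : OC k -> _).
Proof. exact: (@mvec_lipschitz _ _ _ (OC k) (fun w => y k w - alpha *: gf (y k w)) (prox alpha) 1
  (@my_grad k) prox_lip). Qed.

Let sxh k : sqi P (xh k).
Proof.
apply: (@sqi_lipschitz _ _ _ P _ _ _ (fun w => y k w - alpha *: gf (y k w)) prox_lip).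
apply: sqiB; first by case: (sxy k).
by apply: sqiZ; apply: (sqi_lipschitz Hlip); case: (sxy k).
Qed.

Let hstar : h xstar \is a fin_num.
Proof.
have [hN [z hz]] := Hhprop; have := Hmin z; have := hN xstar.
by rewrite /phi_of -(fineK hz); case: (h xstar).
Qed.

Let phistar := f xstar + fine (h xstar).
Let gap (z : 'rV[R]_d) := f z + fine (h z) - phistar.

Lemma gap_ge0 z : h z \is a fin_num -> 0 <= gap z.
Proof.
move=> hz; have := Hmin z.
by rewrite /phi_of -(fineK hz) -(fineK hstar) -!EFinD lee_fin subr_ge0.
Qed.

(** From index 1 on the iterates are proximal points, hence in the domain of [h]; this is what makes
    the real-valued [gap] faithful there. *)
Let h_iterate k w : h (x k.+1 w) \is a fin_num.
Proof. by rewrite xE; exact: (is_prox_fin_num Hhprop (Hprox _ alpha0)). Qed.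

Lemma gap_expE k : gap_exp P (phi_of f h) xstar x k.+1 = (\int[P]_w (gap (x k.+1 w))%:E)%E.
Proof.
apply: eq_integral => w _.
by rewrite /phi_of /gap /phistar -{1}(fineK (h_iterate k w)) -{1}(fineK hstar).
Qed.

Let mgap k : measurable_fun setT (fun w => gap (x k w)).
Proof.
have mx := mvec_sub (@CM k) (mxy k).1.
apply: measurable_funB => //; apply: measurable_funD.
  apply: (mvec_continuous mx) => z.
  by have [dfz _] := Hgf z; exact: (differentiable_continuous dfz).
apply: (measurableT_comp _ (mvec_lsc mx Hhcl)).
exact: fine_measurable.
Qed.

Let expD (X : O -> 'rV[R]_d) := \int[P]_w sqn (X w).

(** The comparison point may be random as long as it is known at time [k]; then the linear error
    term has mean zero. [B] carries the integrability on the side of [z], and integrability of the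
    new gap follows because it lies between 0 and the integrable bound [S]. *)
Lemma expected_step k (z : O -> 'rV[R]_d) (B : O -> R) :
  mvec (z : OC k -> _) -> sqi P z -> (forall w, h (z w) \is a fin_num) ->
  P.-integrable setT (EFin \o B) -> (forall w, gap (z w) <= B w) ->
  P.-integrable setT (EFin \o (fun w => gap (x k.+1 w))) /\
  \int[P]_w gap (x k.+1 w) <= \int[P]_w B w
    + (2 * alpha)^-1 * (expD (fun w => y k w - z w)%R - expD (fun w => x k.+1 w - z w)%R)
    + alpha * (iota0sq * deltasq k).
Proof.
move=> mz sz hz iB gB.
pose u w := xh k w - z w.
have mu : mvec (u : OC k -> _) by exact: (@mvecB _ _ _ (OC k)).
have su : sqi P u by exact: sqiB.
have iX (X : O -> 'rV[R]_d) : sqi P X -> P.-integrable setT (EFin \o (fun w => sqn (X w))).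
  by case.
have iD (p q : O -> R) : P.-integrable setT (EFin \o p) -> P.-integrable setT (EFin \o q) ->
    P.-integrable setT (EFin \o (fun w => p w + q w)).
  move=> ip iq; rewrite (_ : _ \o _ = (EFin \o p) \+ (EFin \o q))//.
  exact: integrableD.
have iZ a (p : O -> R) : P.-integrable setT (EFin \o p) ->
    P.-integrable setT (EFin \o (fun w => a * p w)).
  by move=> ip; exact: (@integrableZl _ _ _ _ _ measurableT a _ ip).
pose t1 w := sqn (err k w).
pose t2 w := dotv (err k w) (u w).
pose t3 w := sqn (y k w - z w).
pose t4 w := sqn (x k.+1 w - z w).
pose t5 w := sqn (Rk k w).
have i1 : P.-integrable setT (EFin \o t1) by exact: iX.
have i2 : P.-integrable setT (EFin \o t2) by exact: sqi_dotv.
have i3 : P.-integrable setT (EFin \o t3) by apply: iX; apply: sqiB => //; case: (sxy k).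
have i4 : P.-integrable setT (EFin \o t4) by apply: iX; apply: sqiB => //; case: (sxy k.+1).
have i5 : P.-integrable setT (EFin \o t5) by exact: iX.
set b := (2 * alpha)^-1.
pose q := - (alpha / 2 * (1 - L * alpha)).
pose S w := B w + ((- 1) * t2 w + (alpha * t1 w + (b * t3 w + ((- b) * t4 w + q * t5 w)))).
have j1 := iD _ _ (iZ (- b) _ i4) (iZ q _ i5).
have j2 := iD _ _ (iZ b _ i3) j1.
have j3 := iD _ _ (iZ alpha _ i1) j2.
have j4 := iD _ _ (iZ (-1) _ i2) j3.
have iS : P.-integrable setT (EFin \o S) by exact: (iD _ _ iB j4).
have gS w : gap (x k.+1 w) <= S w.
  have := prox_step_le Hgf Hfcvx HL Hlip Hhcvx Hhprop alpha0
    (Hprox (y k w - alpha *: g k w) alpha0) (Hprox (y k w - alpha *: gf (y k w)) alpha0) (hz w).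
  rewrite -xE -/(xh k w) -/(err k w) -/(u w) -/(Rk k w) -/(t1 w) -/(t2 w) -/(t3 w) -/(t4 w) -/(t5 w).
  move: (gB w); rewrite /gap /S -/b /q; lra.
have ig : P.-integrable setT (EFin \o (fun w => gap (x k.+1 w))).
  apply: (integrable_dominated _ _ _ iS) => // w _.
  by rewrite ger0_norm ?gap_ge0.
split => //.
apply: (@le_trans _ _ (\int[P]_w S w)).
  by apply: le_Rintegral.
have -> : \int[P]_w S w = \int[P]_w B w + ((- 1) * \int[P]_w t2 w + (alpha * \int[P]_w t1 w +
    (b * \int[P]_w t3 w + ((- b) * \int[P]_w t4 w + q * \int[P]_w t5 w)))).
  rewrite /S (RintegralD measurableT iB j4) (RintegralD measurableT (iZ (-1) _ i2) j3).
  rewrite (RintegralD measurableT (iZ alpha _ i1) j2).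
  rewrite (RintegralD measurableT (iZ b _ i3) j1).
  rewrite (RintegralD measurableT (iZ (- b) _ i4) (iZ q _ i5)).
  by rewrite !RintegralZl.
have -> : \int[P]_w t2 w = 0 by exact: err_unbiased.
have t5_ge0 : 0 <= \int[P]_w t5 w by apply: Rintegral_ge0 => w _; exact: sqn_ge0.
have cR : \int[P]_w sqn (c k w) <= \int[P]_w t5 w.
  rewrite /Rintegral fine_le ?integrable_fin_num//; first exact: (iX _ (sc k)).
  exact: (condexp_vec_sqn_le (@CM k) (cP k) (sRk k) (@measurableT _ (OC k))).
have t1c : \int[P]_w t1 w <= eta ^+ 2 / 4 * \int[P]_w sqn (c k w) + iota0sq * deltasq k.
  have ic : P.-integrable setT (EFin \o (fun w => eta ^+ 2 / 4 * sqn (c k w))).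
    by apply: iZ; exact: (iX _ (sc k)).
  have icst : P.-integrable setT (EFin \o (fun=> iota0sq * deltasq k)) by exact: integrable_cst_prob.
  rewrite -RintegralZl//; last exact: (iX _ (sc k)).
  rewrite -[X in _ <= _ + X]mulr1 -[X in _ <= _ + _ * X](_ : fine (P setT) = 1); last first.
    by rewrite probability_setT.
  rewrite -Rintegral_cst// -RintegralD//.
  rewrite /Rintegral fine_le ?integrable_fin_num//; first exact: iD.
  exact: (err_var (@measurableT _ (OC k))).
(* By [eta < 1]. This makes the variance term comparable with the coefficient [alpha / 2] of the
   residual term. *)
have e1 : eta ^+ 2 / 4 <= eta / 2.
  by rewrite expr2; move: Heta => /andP[h1 h2]; nra.
move: t5_ge0 cR t1c; rewrite -/t3 -/t4 /expD.
move: (\int[P]_w t5 w) (\int[P]_w t1 w) (\int[P]_w sqn (c k w)) => T5 T1 Tc T50 cR t1c.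
rewrite -[fun w => sqn (y k w - z w)]/t3 -[fun w => sqn (x k.+1 w - z w)]/t4.
move: (\int[P]_w t3 w) (\int[P]_w t4 w) (\int[P]_w B w) => T3 T4 TB.
have T1le : alpha * T1 <= alpha * (eta / 2 * T5 + iota0sq * deltasq k).
  rewrite ler_pM2l//; apply: (le_trans t1c); rewrite lerD2r.
  apply: (@le_trans _ _ (eta ^+ 2 / 4 * T5)).
    by rewrite ler_wpM2l// divr_ge0// sqr_ge0.
  by rewrite ler_wpM2r.
(* The step-size condition enters here: [1 - L * alpha - eta >= iota0sq >= 0], so the negative
   residual term absorbs the variance. *)
have : 0 <= alpha / 2 * (1 - L * alpha - eta) * T5.
  rewrite !mulr_ge0 ?(ltW alpha0)// subr_ge0.
  by move: HLalpha Hiota; lra.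
move: T1le; rewrite /q; lra.
Qed.

Let E k := \int[P]_w gap (x k w).

Let gap_xstar : gap xstar = 0.
Proof. by rewrite /gap subrr. Qed.

Let expected_step_xstar k :
  P.-integrable setT (EFin \o (fun w => gap (x k.+1 w))) /\
  \int[P]_w gap (x k.+1 w) <= \int[P]_w (fun=> 0) w
    + (2 * alpha)^-1 * (expD (fun w => y k w - xstar)%R - expD (fun w => x k.+1 w - xstar)%R)
    + alpha * (iota0sq * deltasq k).
Proof.
apply: (@expected_step k (fun=> xstar) (fun=> 0)) => //.
- exact: sqi_cst.
- exact: integrable_cst_prob.
- by move=> w; rewrite gap_xstar.
Qed.

Lemma gap_integrable k : P.-integrable setT (EFin \o (fun w => gap (x k.+1 w))).
Proof.
exact: (expected_step_xstar k).1.
Qed.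

Let EtermE k : gap_exp P (phi_of f h) xstar x k.+1 = (E k.+1)%:E.
Proof. by rewrite gap_expE /E /Rintegral fineK// integrable_fin_num//; exact: gap_integrable. Qed.

Let E_ge0 k : 0 <= E k.+1.
Proof. by apply: Rintegral_ge0 => w _; exact: gap_ge0. Qed.

Let expD_ge0 X : 0 <= expD X.
Proof. by apply: Rintegral_ge0 => w _; exact: sqn_ge0. Qed.

Let b_ge0 : 0 <= (2 * alpha)^-1.
Proof. by rewrite invr_ge0 mulr_ge0// ltW. Qed.

Lemma iterations_option1 (S : R) : optII = false ->
  (forall n, \sum_(k < n) deltasq k <= S) ->
  exists2 K, 0 < K & iterations_le (gap_exp P (phi_of f h) xstar x) 1 K.
Proof.
move=> opt dS.
have S0 : 0 <= S by have := dS 0%N; rewrite big_ord0.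
pose D k := expD (fun w => y k w - xstar).
pose M := (2 * alpha)^-1 * D 0%N + alpha * iota0sq * S.
have M0 : 0 <= M.
  by rewrite addr_ge0 ?mulr_ge0 ?b_ge0 ?expD_ge0 ?(ltW alpha0).
exists (1 + M); first by rewrite ltr_wpDr.
apply: (iterations_le_sum EtermE M0).
apply: (telescoping_sum_le (D := D) (e := fun k => alpha * (iota0sq * deltasq k))) => //.
- by move=> k; exact: expD_ge0.
- move=> n; under eq_bigr do rewrite mulrA.
  by rewrite -mulr_sumr ler_wpM2l// mulr_ge0// ltW.
move=> k; have := (expected_step_xstar k).2.
rewrite Rintegral_cst// mul0r add0r -/(E k.+1) (_ : (fun w => x k.+1 w - xstar) = (fun w => y k.+1 w - xstar))//.
by apply/funext => w; rewrite yE opt.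
Qed.

Let gap_convex u t : 0 <= t <= 1 -> h u \is a fin_num ->
  h (t *: u + (1 - t) *: xstar) \is a fin_num /\
  gap (t *: u + (1 - t) *: xstar) <= t * gap u.
Proof.
move=> t01 hu; have := Hhcvx u xstar t01; have := Hfcvx u xstar t01.
set z := _ + _ *: xstar => fz hz.
have hzf : h z \is a fin_num.
  have [hN _] := Hhprop; move: hz; have := hN z.
  by rewrite -(fineK hu) -(fineK hstar); case: (h z).
split => //; move: hz; rewrite -(fineK hu) -(fineK hstar) -(fineK hzf).
by rewrite -!(EFinM, EFinD) lee_fin /gap /phistar /=; lra.
Qed.

Lemma iterations_option2 (S : R) : optII = true ->
  (forall n, \sum_(k < n) k.+1%:R ^+ 2 * deltasq k <= S) ->
  exists2 K, 0 < K & iterations_le (gap_exp P (phi_of f h) xstar x) (1 / 2) K.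
Proof.
move=> opt dS.
have S0 : 0 <= S by have := dS 0%N; rewrite big_ord0.
(* Since [beta_k = (k - 1) / (k + 2)], for [k >= 1] this equals
   [x_(k-1) + (x_k - x_(k-1)) / theta_k], the usual auxiliary sequence, and at 0 it is [x_0]. In
   this form, with [theta = 2 / (k + 2)], both [y_k - z = theta (v_k - xstar)] and
   [x_(k+1) - z = theta (v_(k+1) - xstar)] hold. *)
pose v k w := x k w + (k.+2%:R / 2) *: (y k w - x k w).
pose V k := expD (fun w => v k w - xstar).
pose M := (2 * alpha)^-1 * V 0%N + alpha * iota0sq * S.
have M0 : 0 <= M.
  by rewrite addr_ge0 ?mulr_ge0 ?b_ge0 ?expD_ge0 ?(ltW alpha0).
exists (1 + 4 * M); first by rewrite ltr_wpDr// mulr_ge0.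
apply: (iterations_le_sqr EtermE M0).
apply: (accelerated_recursion_le (V := V) (e := fun k => alpha * (iota0sq * deltasq k))) => //.
- by move=> k; exact: expD_ge0.
- by move=> k; apply: mulr_ge0; [exact: ltW|exact: mulr_ge0].
- move=> n; rewrite (eq_bigr (fun k : 'I_n => alpha * iota0sq * (k.+1%:R ^+ 2 * deltasq k))).
    by rewrite -mulr_sumr; apply: ler_wpM2l; [rewrite mulr_ge0// ltW|exact: dS].
  by move=> k _; ring.
move=> k /=; set theta := 2 / _.
have k2 : 0 < k.+2%:R :> R by rewrite ltr0n.
have k2k : k.+2%:R = k%:R + 2 :> R by rewrite -natrD addn2.
have k2' : k%:R + 2 != 0 :> R by rewrite -k2k gt_eqF.
pose t := 1 - theta.
have tE : t = k%:R / k.+2%:R by rewrite /t /theta k2k; field.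
have t01 : 0 <= t <= 1.
  by rewrite tE divr_ge0//= ler_pdivrMr// mul1r ler_nat; exact: ltnW.
have thetaE : theta = 1 - t by rewrite /t; ring.
(* At [k = 0] the weight [t] is 0, so [z] is [xstar] and [x_0] need not lie in the domain of [h];
   the cases on [k] below reflect this. *)
pose z w := t *: x k w + (1 - t) *: xstar.
have hz w : h (z w) \is a fin_num /\ gap (z w) <= t * gap (x k w).
  have [k0|k0] := posnP k.
    have t0 : t = 0 by rewrite tE k0 mul0r.
    by rewrite /z t0 scale0r add0r subr0 scale1r gap_xstar mul0r; split.
  by apply: gap_convex => //; rewrite -(prednK k0).
have iB : P.-integrable setT (EFin \o (fun w => t * gap (x k w))) /\
    \int[P]_w (t * gap (x k w)) = t * E k.
  have [k0|k0] := posnP k.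
    have t0 : t = 0 by rewrite tE k0 mul0r.
    rewrite (_ : (fun w => _) = (fun=> 0)); last by apply/funext => w; rewrite t0 !mul0r.
    by rewrite Rintegral_cst// t0 !mul0r; split=> //; exact: integrable_cst_prob.
  have ik : P.-integrable setT (EFin \o (fun w => gap (x k w))).
    by rewrite -(prednK k0); exact: gap_integrable.
  by split; [exact: (integrableZl measurableT t ik)|rewrite RintegralZl].
have mz : mvec (z : OC k -> _).
  apply: (@mvecD _ _ _ (OC k)); last exact: (@mvec_cst _ _ _ (OC k)).
  by apply: (@mvecZ _ _ _ (OC k)); case: (mxy k).
have sz : sqi P z.
  apply: sqiD; last exact: sqi_cst.
  by apply: sqiZ; case: (sxy k).
have [_] := expected_step mz sz (fun w => (hz w).1) iB.1 (fun w => (hz w).2).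
have expDZ (X Y : O -> 'rV[R]_d) : sqi P Y -> (forall w, X w = theta *: Y w) ->
    expD X = theta ^+ 2 * expD Y.
  move=> [_ iY] XY; rewrite /expD -RintegralZl//.
  by apply: eq_Rintegral => w _; rewrite XY sqnZ.
have sv j : sqi P (fun w => v j w - xstar).
  apply: sqiB; last exact: sqi_cst.
  have [sx sy] := sxy j; apply: sqiD => //; apply: sqiZ; exact: sqiB.
rewrite (expDZ (fun w => y k w - z w) _ (sv k)); last first.
  move=> w; rewrite /z /v /t /theta k2k.
  by apply/rowP => i; rewrite !mxE; field.
rewrite (expDZ (fun w => x k.+1 w - z w) _ (sv k.+1)); last first.
  have k3k : k.+3%:R = k%:R + 3 :> R by rewrite -natrD addn3.
  have k3' : k%:R + 3 != 0 :> R by rewrite -k3k pnatr_eq0.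
  have k1k : k.+1%:R = k%:R + 1 :> R by rewrite -natr1.
  move=> w; rewrite /z /v yE opt /beta_acc /t /theta k2k k3k k1k.
  have k12 : k%:R + 1 + 2 != 0 :> R by rewrite -addrA (_ : 1 + 2 = 3)//; ring.
  by apply/rowP => i; rewrite !mxE; field; rewrite k12.
rewrite iB.2 -/(E k.+1) -/(V k) -/(V k.+1) -/t => /le_trans; apply.
by rewrite le_eqVlt; apply/orP; left; apply/eqP; ring.
Qed.

(** The exact residual [r] is known at time [k] and [|R_k - r| <= |e_k|] by nonexpansiveness.
    Jensen's inequality and the localised variance bound give [|c_k - r|^2 <= eta^2 / 4 |c_k|^2] in
    integral over every [G_k]-event; the event where it fails is one of them, hence null. Then
    [|r|^2 <= 2 |c_k|^2 + 2 |c_k - r|^2]. *)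
Lemma residual_le k : iota0sq * deltasq k = 0 ->
  {ae P, forall w, sqn (Rtrue prox gf alpha (y k w)) <= (2 + eta ^+ 2 / 2) * sqn (c k w)}.
Proof.
move=> id0; pose r w := Rtrue prox gf alpha (y k w).
have mr : mvec (r : OC k -> _).
  apply: (@mvecZ _ _ _ (OC k)); apply: (@mvecB _ _ _ (OC k)); first by case: (mxy k).
  exact: mxh.
have sr : sqi P r.
  by apply: sqiZ; apply: sqiB; [case: (sxy k)|exact: sxh].
have cB := condexp_vecB (@CM k) (cP k) mr sr.
have sRr : sqi P (fun w => Rk k w - r w) by exact: sqiB.
have scr : sqi P (fun w => c k w - r w) by exact: sqiB.
have mcr := condexp_vec_mvec cB.
have ic : P.-integrable setT (EFin \o (fun w => eta ^+ 2 / 4 * sqn (c k w))).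
  by case: (sc k) => _ i; exact: (@integrableZl _ _ _ _ _ measurableT (eta ^+ 2 / 4) _ i).
have CA : <<s C k >> [set w | eta ^+ 2 / 4 * sqn (c k w) < sqn (c k w - r w)].
  have m1 : measurable_fun (setT : set (OC k)) (fun w => eta ^+ 2 / 4 * sqn (c k w)).
    by apply: measurable_funM => //; apply: mvec_sqn; exact: (condexp_vec_mvec (cP k)).
  have m2 : measurable_fun (setT : set (OC k)) (fun w => sqn (c k w - r w)).
    exact: mvec_sqn.
  have := @measurable_fun_ltr _ (OC k) R setT _ _ m1 m2 (@measurableT _ (OC k)) [set true] I.
  by rewrite setTI; congr (<<s C k >> _); apply/seteqP; split.
have mA := CM CA.
have : {ae P, forall w, sqn (c k w - r w) <= eta ^+ 2 / 4 * sqn (c k w)}.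
  apply: negligible_of_integral_le => //; first by case: scr.
  apply: (le_trans (condexp_vec_sqn_le (@CM k) cB sRr CA)).
  apply: (@le_trans _ _ (\int[P]_(w in [set w | (eta ^+ 2 / 4 * sqn (c k w) < sqn (c k w - r w))%R])
      (sqn (err k w))%:E)%E).
    apply: ge0_le_integral => //.
    - by move=> w _; rewrite lee_fin sqn_ge0.
    - by apply/measurable_EFinP; apply: measurable_funTS; apply: mvec_sqn; case: sRr.
    - by apply/measurable_EFinP; apply: measurable_funTS; apply: mvec_sqn; case: (err_sqi k).
    move=> w _; rewrite lee_fin /r /Rtrue /Rk -scalerBr sqnZ.
    have -> : y k w - x k.+1 w - (y k w - prox alpha (y k w - alpha *: gf (y k w))) =
        - (x k.+1 w - prox alpha (y k w - alpha *: gf (y k w))).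
      by apply/rowP => i; rewrite !mxE; ring.
    rewrite sqnN xE.
    have := prox_lip (y k w - alpha *: g k w) (y k w - alpha *: gf (y k w)).
    rewrite mul1r (_ : y k w - alpha *: g k w - _ = (- alpha) *: err k w); last first.
      by rewrite /err; apply/rowP => i; rewrite !mxE; ring.
    rewrite sqnZ sqrrN => H.
    by rewrite exprVn ler_pdivrMl ?exprn_gt0.
  by have := err_var CA; rewrite id0; under [X in (_ <= X)%E -> _]eq_integral do rewrite addr0.
apply: filterS => w Hw; rewrite -/(r w).
have -> : r w = c k w - (c k w - r w) by rewrite opprB addrC subrK.
have := sqnD_le (c k w) (- (c k w - r w)); rewrite sqnN; lra.
Qed.

(** The denominator of the sample-size rule is now [eta^2 / 4 |c_k|^2], bounded below through
    [residual_le]; this is the origin of the factor [4 / eta^2 (2 + eta^2 / 2)]. The null sets of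
    all [k] are united into one. *)
Lemma sample_size_residual : (forall k, iota0sq * deltasq k = 0) ->
  {ae P, forall w k, 0 < sqn (Rtrue prox gf alpha (y k w)) ->
    (N k w)%:R <= 2 + sigma ^+ 2 * (4 / eta ^+ 2 * (2 + eta ^+ 2 / 2)) /
      sqn (Rtrue prox gf alpha (y k w))}.
Proof.
move=> id0; have := ae_foralln (fun k => residual_le (id0 k)).
apply: filterS => w Hw k r0; have [D0 ->] := NP k w.
apply: (le_trans (sample_size_ub sigma D0)); rewrite lerD2l.
move: D0; rewrite id0 addr0 => D0.
have := Hw k; set r := sqn (Rtrue _ _ _ _) in r0 *; set s := sqn (c k w) in D0 * => rs.
have eta0 : 0 < eta by case/andP: Heta.
rewrite -[leRHS]mulrA ler_wpM2l ?sqr_ge0// -[leLHS]mul1r ler_pdivrMr//.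
rewrite mulrAC ler_pdivlMr// mul1r; apply: (le_trans rs).
rewrite le_eqVlt; apply/orP; left; apply/eqP; field.
by rewrite gt_eqF.
Qed.

Lemma evals_no_delta (a K rate : R) : 0 <= a -> 0 < K -> a + 1 <= rate ->
  iterations_le (gap_exp P (phi_of f h) xstar x) a K ->
  (forall k, iota0sq * deltasq k = 0) ->
  evals_bigO P (gap_exp P (phi_of f h) xstar x)
    (fun k w => sqn (Rtrue prox gf alpha (y k w))) N rate.
Proof.
move=> a0 K0 arate iK id0.
apply: (evals_bigO_residual a0 K0 _ arate iK (sample_size_residual id0)).
by rewrite mulr_ge0 ?sqr_ge0// mulr_ge0 ?addr_ge0 ?divr_ge0 ?sqr_ge0.
Qed.

(** For [iota0sq > 0] the denominator is at least [iota0sq (k + 1)^(-b)], so the cost grows at most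
    like [(k + 1)^b]. For [iota0sq = 0] the sequence [deltasq] has no effect and the residual bound
    is used; hence both conditions on [rate]. *)
Lemma evals_power_delta (a b K rate : R) : 0 <= a -> 0 <= b -> 0 < K ->
  a + 1 <= rate -> a * (1 + b) <= rate ->
  iterations_le (gap_exp P (phi_of f h) xstar x) a K ->
  (forall k, deltasq k = k.+1%:R `^ (- b)) ->
  evals_bigO P (gap_exp P (phi_of f h) xstar x)
    (fun k w => sqn (Rtrue prox gf alpha (y k w))) N rate.
Proof.
move=> a0 b0 K0 arate abrate iK dE.
have [i0|i0] := eqVneq iota0sq 0.
  by apply: (evals_no_delta a0 K0) => // k; rewrite i0 mul0r.
have ip : 0 < iota0sq by rewrite lt_neqAle eq_sym i0.
have Cn0 : 0 < 2 + sigma ^+ 2 / iota0sq by rewrite ltr_wpDr// divr_ge0 ?sqr_ge0.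
apply: (evals_bigO_poly P _ a0 b0 K0 Cn0 abrate iK) => k w.
have [D0 ->] := NP k w; apply: (le_trans (sample_size_ub sigma D0)).
have k1 : 1 <= k.+1%:R `^ b :> R.
  by rewrite -[leLHS](powRr0 (k.+1%:R : R)) ler_powR// ler1n.
rewrite mulrDl lerD//; first by rewrite ler_peMr.
rewrite -[leRHS]mulrA ler_wpM2l ?sqr_ge0//.
have p0 : 0 < k.+1%:R `^ b :> R by exact: lt_le_trans k1.
rewrite -[k.+1%:R `^ b]invrK -invfM -powRN -dE lef_pV2 ?posrE//.
  by rewrite lerDr mulr_ge0 ?sqn_ge0// divr_ge0 ?sqr_ge0.
by rewrite mulr_gt0// dE powR_gt0.
Qed.

End Run.

Theorem mainTheorem12
  (R : realType) (d : nat)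
  (dO : measure_display) (O : measurableType dO) (P : probability O R)
  (dX : measure_display) (Xi : measurableType dX) (Pxi : probability Xi R)
  (F : 'rV[R]_d -> Xi -> R) (gF : 'rV[R]_d -> Xi -> 'rV[R]_d)
  (f : 'rV[R]_d -> R) (gf : 'rV[R]_d -> 'rV[R]_d)
  (h : 'rV[R]_d -> \bar R) (prox : R -> 'rV[R]_d -> 'rV[R]_d)
  (L sigma eta iota0sq alpha nu : R) (xstar : 'rV[R]_d)
  (* (EX): f(x) = E[F(x,xi)], grad F(.,xi) is the gradient of F(.,xi), and the
     stochastic gradient is unbiased *)
  (HF : forall z : Xi, is_gradient (fun x => F x z) (fun x => gF x z))
  (HEX : forall x, Pxi.-integrable setT (fun z => (F x z)%:E) /\
                   (f x)%:E = (\int[Pxi]_(z in setT) (F x z)%:E)%E)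
  (Hunb : forall x (j : 'I_d), Pxi.-integrable setT (fun z => (gF x z 0 j)%:E) /\
                   (\int[Pxi]_(z in setT) (gF x z 0 j)%:E)%E = (gf x 0 j)%:E)
  (* Assumption B *)
  (Hfcvx : convex_fun f) (Hgf : is_gradient f gf) (HL : 0 < L)
  (Hlip : forall u v, enorm (gf u - gf v) <= L * enorm (u - v))
  (Hhcvx : convex_efun h) (Hhprop : proper_efun h) (Hhcl : closed_efun h)
  (Hprox : forall (a : R) (v : 'rV[R]_d), 0 < a -> is_prox h a v (prox a v))
  (* x^* minimizes phi = f + h *)
  (Hmin : forall z, (phi_of f h xstar <= phi_of f h z)%E)
  (* parameters *)
  (Hsigma : 0 <= sigma)
  (Heta : 0 < eta < 1)
  (Hiota : 0 <= iota0sq < 1 - eta)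
  (Halpha : 0 < alpha <= (1 - eta - iota0sq) / L)
  (Hnu : 0 < nu) :
  let Eterm x := gap_exp P (phi_of f h) xstar x in
  let rterm y k w := sqn (Rtrue prox gf alpha (y k w)) in
  let run optII deltasq x y g c N xi :=
    sampled_run P Pxi gF prox optII alpha sigma eta iota0sq deltasq x y g c N xi /\
    assumptionV P Pxi gF gf sigma y in
  (* (1) Option I, tilde delta_k^2 = 1/(k+1)^(1+nu) : O(eps^-(2+nu)) *)
  (forall x y g c N xi,
     run false (fun k => (k.+1%:R : R) `^ (- (1 + nu))) x y g c N xi ->
     evals_bigO P (Eterm x) (rterm y) N (2 + nu)) /\
  (* (1') Option I, tilde delta_k = 0 : O(eps^-2) *)
  (forall x y g c N xi,
     run false (fun _ => 0) x y g c N xi ->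
     evals_bigO P (Eterm x) (rterm y) N 2) /\
  (* (2) Option II (convex acceleration), tilde delta_k^2 = 1/(k+1)^(3+2nu) :
         O(eps^-(2+nu)) *)
  (forall x y g c N xi,
     run true (fun k => (k.+1%:R : R) `^ (- (3 + 2 * nu))) x y g c N xi ->
     evals_bigO P (Eterm x) (rterm y) N (2 + nu)) /\
  (* (2') Option II (convex acceleration), tilde delta_k = 0 : O(eps^-3/2) *)
  (forall x y g c N xi,
     run true (fun _ => 0) x y g c N xi ->
     evals_bigO P (Eterm x) (rterm y) N (3 / 2)).
Proof.
move=> Eterm rterm run.
(* Measurability of [F] in the sample is extracted from the integrability in the expectation
   model. *)
have mF x : measurable_fun setT (F x).
  by apply/measurable_EFinP; case: (HEX x) => /integrableP[].
have lipsq u v : sqn (gf u - gf v) <= L ^+ 2 * sqn (u - v).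
  rewrite -!enorm_sqr -exprMn ler_pXn2r ?nnegrE ?mulr_ge0 ?sqrtr_ge0//.
  exact: ltW.
have /andP[alpha0 alphaL] := Halpha.
have /andP[iota0 _] := Hiota.
have HLa : L * alpha <= 1 - eta - iota0sq by rewrite mulrC -ler_pdivlMr.
have nu0 := ltW Hnu.
split; [|split; [|split]] => x y g c N xi [Hrun HV].
- have [K K0 iK] := iterations_option1 HF mF Hunb Hfcvx Hgf HL lipsq Hhcvx Hhprop Hhcl
    Hprox Hmin Heta iota0 alpha0 HLa Hrun HV erefl (fun n => sum_inv_powR_le n Hnu).
  (* Here [a = 1] and [b = 1 + nu], so [a (1 + b) = 2 + nu]. *)
  apply: (evals_power_delta HF mF Hunb lipsq Hhcvx Hhprop Hprox Heta iota0 alpha0 Hrun HV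
    (b := 1 + nu) _ _ K0 _ _ iK) => //; lra.
- have d0 n : \sum_(k < n) (fun=> 0 : R) k <= 0 by rewrite big1.
  have [K K0 iK] := iterations_option1 HF mF Hunb Hfcvx Hgf HL lipsq Hhcvx Hhprop Hhcl
    Hprox Hmin Heta iota0 alpha0 HLa Hrun HV erefl d0.
  apply: (evals_no_delta HF mF Hunb lipsq Hhcvx Hhprop Hprox Heta alpha0 Hrun HV _ K0 _ iK) => //.
  by move=> k; rewrite mulr0.
- have nu2 : 0 < 2 * nu by rewrite mulr_gt0.
  (* The acceleration weight [(k + 1)^2] lowers the exponent to [1 + 2 nu], which is summable. *)
  have dS n : \sum_(k < n) k.+1%:R ^+ 2 * (k.+1%:R : R) `^ (- (3 + 2 * nu)) <= 1 + (2 * nu)^-1.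
    apply: le_trans (sum_inv_powR_le n nu2).
    apply: ler_sum => k _; rewrite -powR_mulrn// -powRD ?pnatr_eq0 ?implybT//.
    by rewrite (_ : 2%:R + _ = - (1 + 2 * nu))//; lra.
  have [K K0 iK] := iterations_option2 HF mF Hunb Hfcvx Hgf HL lipsq Hhcvx Hhprop Hhcl
    Hprox Hmin Heta iota0 alpha0 HLa Hrun HV (fun k => powR_ge0 _ _) erefl dS.
  (* Here [a = 1 / 2] and [b = 3 + 2 nu], so again [a (1 + b) = 2 + nu]. *)
  apply: (evals_power_delta HF mF Hunb lipsq Hhcvx Hhprop Hprox Heta iota0 alpha0 Hrun HV
    (b := 3 + 2 * nu) _ _ K0 _ _ iK) => //; lra.
- have d0 n : \sum_(k < n) k.+1%:R ^+ 2 * (fun=> 0 : R) k <= 0.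
    by rewrite big1// => k _; rewrite mulr0.
  have [K K0 iK] := iterations_option2 HF mF Hunb Hfcvx Hgf HL lipsq Hhcvx Hhprop Hhcl
    Hprox Hmin Heta iota0 alpha0 HLa Hrun HV (fun=> lexx 0) erefl d0.
  apply: (evals_no_delta HF mF Hunb lipsq Hhcvx Hhprop Hprox Heta alpha0 Hrun HV _ K0 _ iK); [lra|lra|].
  by move=> k; rewrite mulr0.
Qed.
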